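(* Let $n\geq 3$, let $\delta\in[0,1]$, and let $i,j,k\in\{1,\dots,n\}$ be pairwise distinct indices. Then there is a constant $C>0$ such that for every $f\in L^2(\mathbb{R}^n)$, the solution $u$ of $$ i\frac{\partial}{\partial t}u=-\triangle u+|x|^2u \ \text{ in } \mathbb{R}^{n+1},\qquad u(x,0)=f(x), $$ satisfies $$ \int_0^{2\pi}\int_{\mathbb{R}^n}\frac{|u(x,t)|^2}{(x_i^2+x_j^2+x_k^2)^{\delta}}\,dx\,dt\leq C\|f\|_2^2 . $$ In particular, taking $\delta=1$, for $n\geq 3$ one has the Kato estimate $$ \int_0^{2\pi}\int_{\mathbb{R}^n}\frac{|u(x,t)|^2}{|x|^2}\,dx\,dt\leq C\|f\|_2^2 . $$
   Context: Here $x=(x_1,\dots,x_n)\in\mathbb{R}^n$, $t\in\mathbb{R}$, $\triangle$ is the Laplacian in $x$, and $\|\cdot\|_2$ is the norm of $L^2(\mathbb{R}^n)$. The solution is $u(\cdot,t)=e^{-it(-\triangle+|x|^2)}f$, that is, $u(x,t)=\sum_\alpha e^{-i(2|\alpha|+n)t}a_\alpha\Phi_\alpha(x)$ with convergence in $L^2(\mathbb{R}^n)$. The sum is over $n$-multiindices $\alpha$ of nonnegative integers, $|\alpha|=\alpha_1+\dots+\alpha_n$, $\Phi_\alpha(x)=\prod_{l=1}^n h_{\alpha_l}(x_l)$, $a_\alpha=\int_{\mathbb{R}^n}f\,\Phi_\alpha\,dx$, and $h_m(s)=\frac{(-1)^m}{(2^m m!\sqrt{\pi})^{1/2}}e^{s^2/2}\frac{d^m}{ds^m}(e^{-s^2})$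 are the normalized one-dimensional Hermite functions. The solution is $2\pi$-periodic in $t$. *)

(* Defs.v *)
From HB Require Import structures.
From mathcomp Require Import all_boot all_order all_algebra finmap.
From mathcomp Require Import all_classical all_reals all_analysis.
From mathcomp Require Import complex summability.

Set Implicit Arguments.
Unset Strict Implicit.
Unset Printing Implicit Defensive.

Import Order.TTheory GRing.Theory Num.Theory.
Import numFieldNormedType.Exports.
Export Normc (normc).

Local Open Scope classical_set_scope.
Local Open Scope ring_scope.
Local Open Scope complex_scope.

(* R^n is [n.-tuple R] with the product sigma-algebra, which is the Borel one.
   Lebesgue measure on it is built one coordinate at a time: [leb n.+1] is the
   image of [lebesgue_measure \x leb n] under [(s, y) |-> s :: y].            *)
Section LebesgueMeasure.
Context {R : realType}.

Definition cons_pair n (p : measurableTypeR R * n.-tuple R) : n.+1.-tuple R :=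
  [the n.+1.-tuple R of (p.1 : R) :: p.2].

Lemma measurable_cons_pair n : measurable_fun [set: _] (@cons_pair n).
Proof. by apply: measurable_cons; [exact: measurable_fst|]. Qed.

Definition uncons n (x : n.+1.-tuple R) : measurableTypeR R * n.-tuple R :=
  (tnth x ord0, [tuple of behead x]).

Lemma measurable_uncons n : measurable_fun [set: _] (@uncons n).
Proof.
apply: measurable_fun_pair; last exact: measurable_behead.
exact: (@measurable_tnth _ R n.+1 ord0).
Qed.

Lemma cons_pairK n : cancel (@cons_pair n) (@uncons n).
Proof.
by case=> s y; rewrite /uncons /cons_pair tnth0; congr pair; exact: val_inj.
Qed.

Section Step.
Variables (n : nat) (mu : {sigma_finite_measure set (n.-tuple R) -> \bar R}).

Definition leb_step : set (n.+1.-tuple R) -> \bar R :=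
  pushforward (lebesgue_measure \x mu)%E (@cons_pair n).

Let measurable_preimage_cons A :
  measurable A -> measurable (@cons_pair n @^-1` A).
Proof.
by move=> mA; rewrite -[X in measurable X]setTI; exact: measurable_cons_pair.
Qed.

Let leb_step0 : leb_step set0 = 0%E.
Proof. by rewrite /leb_step /pushforward preimage_set0 measure0. Qed.

Let leb_step_ge0 A : (0 <= leb_step A)%E.
Proof. by rewrite /leb_step /pushforward; exact: measure_ge0. Qed.

Let leb_step_sigma_additive : semi_sigma_additive leb_step.
Proof.
move=> F mF tF mUF; rewrite /leb_step /pushforward preimage_bigcup.
apply: measure_semi_sigma_additive.
- by move=> k; exact: measurable_preimage_cons.
- apply/trivIsetP => /= i j _ _ ij; rewrite -preimage_setI.
  by move/trivIsetP : tF => /(_ _ _ _ _ ij) ->//; rewrite preimage_set0.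
- by rewrite -preimage_bigcup; exact: measurable_preimage_cons.
Qed.

HB.instance Definition _ := isMeasure.Build _ _ _ leb_step
  leb_step0 leb_step_ge0 leb_step_sigma_additive.

Let leb_step_sigma_finite : sigma_finite setT leb_step.
Proof.
have /sigma_finiteP[F [TF ndF Foo]] :=
  sigma_finiteT (@lebesgue_measure R : {sigma_finite_measure set _ -> \bar R}).
have /sigma_finiteP[G [TG ndG Goo]] := sigma_finiteT mu.
exists (fun k => @uncons n @^-1` (F k `*` G k)).
  rewrite -preimage_bigcup -[LHS](preimage_setT (@uncons n)); congr (_ @^-1` _).
  rewrite -setXTT TF TG predeqE => -[x y]; split.
    move=> [/= [p _ Fpx] [q _ Gqy]]; exists (maxn p q) => //; split.
    - by move: x Fpx; exact/subsetPset/ndF/leq_maxl.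
    - by move: y Gqy; exact/subsetPset/ndG/leq_maxr.
  by move=> [p _ []/= ? ?]; split; exists p.
move=> k; have [mF Fkoo] := Foo k; have [mG Gkoo] := Goo k; split.
  rewrite -[X in measurable X]setTI.
  by apply: measurable_uncons => //; exact: measurableX.
rewrite /leb_step /pushforward -comp_preimage.
rewrite (_ : @uncons n \o @cons_pair n = id); last first.
  by apply/funext => p /=; rewrite cons_pairK.
by rewrite preimage_id product_measure1E// lte_mul_pinfty// ge0_fin_numE.
Qed.

HB.instance Definition _ :=
  Measure_isSigmaFinite.Build _ _ _ leb_step leb_step_sigma_finite.

End Step.

Fixpoint leb n : {sigma_finite_measure set (n.-tuple R) -> \bar R} :=
  if n is n'.+1 then leb_step (leb n') else \d_[tuple].

End LebesgueMeasure.
Arguments leb {R} n.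

Section Hermite.
Context {R : realType}.

Definition hermite (m : nat) (s : R) : R :=
  (-1) ^+ m / Num.sqrt (2 ^+ m * m`!%:R * Num.sqrt pi) *
  expR (s ^+ 2 / 2) * ((fun r : R => expR (- r ^+ 2))^`(m))%classic s.

Definition Phi n (a : n.-tuple nat) (x : n.-tuple R) : R :=
  \prod_(l < n) hermite (tnth a l) (tnth x l).

Definition mlen n (a : n.-tuple nat) : nat := \sum_(l < n) tnth a l.

End Hermite.

Section Schrodinger.
Context {R : realType}.

Definition L2norm n (f : n.-tuple R -> R[i]) : \bar R :=
  ('N[leb n]_(2%:E)[EFin \o (fun x => normc (f x))])%E.

Definition in_L2 n (f : n.-tuple R -> R[i]) : Prop :=
  [/\ measurable_fun setT (@complex.Re R \o f),
      measurable_fun setT (@complex.Im R \o f)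
    & (L2norm f < +oo)%E].

Definition hermite_coef n (f : n.-tuple R -> R[i]) (a : n.-tuple nat) : R[i] :=
  (\int[leb n]_x (complex.Re (f x) * Phi a x))
  +i* (\int[leb n]_x (complex.Im (f x) * Phi a x)).

(* expNi th = e^{-i th} *)
Definition expNi (th : R) : R[i] := cos th -i* sin th.

Definition hermite_sum n (f : n.-tuple R -> R[i]) (A : {fset n.-tuple nat})
    (t : R) (x : n.-tuple R) : R[i] :=
  \sum_(a <- A) expNi ((2 * mlen a + n)%N%:R * t) * hermite_coef f a
                * (Phi a x)%:C.

(* u(., t) = e^{-it(-Delta + |x|^2)} f: for each [t], [u(., t)] represents the
   L^2 sum of the Hermite expansion, summed unconditionally over multi-indices
   (limit along the finite sets of indices). The representative may be chosen
   independently for each [t]: an integral over x that is then integrated in t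
   depends only on the classes of u(., t).                                    *)
Definition schrodinger_solution n (f : n.-tuple R -> R[i])
    (u : n.-tuple R -> R -> R[i]) : Prop :=
  forall t : R, in_L2 (u ^~ t) /\
    L2norm (fun x => u x t - hermite_sum f A t x) @[A --> totally] --> 0%E.

End Schrodinger.

(* Main.v *)
Require Import Defs.
From mathcomp Require Import all_boot all_order all_algebra finmap.
From mathcomp Require Import all_classical all_reals all_analysis.
From mathcomp Require Import complex measurable_realfun.
From mathcomp Require Import ring lra zify.

(* Let rho = x_i^2 + x_j^2 + x_k^2 and expand f = sum_a c_a Phi_a. Both weights
   are at most sum_(k >= 0) exp (- k rho) = 1 / (1 - exp (- rho)), so Gaussian
   weights suffice. Integration in t kills the products of waves of different
   frequencies and leaves, for each k, the sum over |a| = |b| of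
   c_a (c_b)^* <Phi_a, exp (- k rho) Phi_b>. This matrix is a tensor product,
   and in one variable exp (- s x^2) = sqrt sigma * A^* sigma^(number) A with
   sigma = 1 / (1 + s) and A the exponential of a multiple of the squared
   annihilation operator; its entries are the [mehler_coef] below. A weighted
   Cauchy-Schwarz inequality and Vandermonde-type convolutions bound the form by
   the diagonal one with entries psi_k(a), where, for L = a_i + a_j + a_k + 1,
     psi_k(a) <= min (1, 1 / sqrt (L k), sqrt L / (1 + k)^(3/2)),
   and the sum over k of this minimum is bounded independently of L. Bessel's
   inequality and Fatou's lemma conclude. *)

(** The square of a Mehler coefficient is a coefficient of (1 - e X)^(-(m + 1) / 2) times a
    coefficient of (1 + e X)^(a / 2). With these two as the weights of the Cauchy-Schwarz
    inequality, the sums over multi-indices become coefficients of products of such series.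
    Exponents add up over the coordinates, so the bound depends on the entries in [S] only through
    their sum. This requires the level of b to be fixed, which is what the average in time provides.
    The number three enters twice. For L = 1 the diagonal entry is (1 + k)^(-3/2), where two
    coordinates would already give the harmonic series. It also makes two products of half-integers
    interleave into a single binomial coefficient. The final constant 20 pi is 2 * 2 pi * 5: a
    factor 2 from comparing u with its partial sums, the length of the period, and the bound 5 on
    the sum over k. *)

Set Implicit Arguments.
Unset Strict Implicit.
Unset Printing Implicit Defensive.

Import Order.TTheory GRing.Theory Num.Theory.
Import numFieldNormedType.Exports.
Local Open Scope classical_set_scope.
Local Open Scope ring_scope.

(** * Combinatorics of the Mehler coefficients *)

Section BinomialLike.
Context {R : realFieldType}.
Implicit Types (e x y mu : R) (c d : nat -> R).

(* Satisfied, with equality, by the coefficients of (1 - e X)^(- x) for mu = 1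
   and by those of (1 + e X)^x for mu = - 1, as long as they are nonnegative. *)
Definition binomial_like e x mu c :=
  [/\ forall k, 0 <= c k, c 0%N <= 1
    & forall k, k.+1%:R * c k.+1 <= e * (x + mu * k%:R) * c k].

(** The recurrence is the coefficientwise form of F' <= e (x F + mu X F'). The product rule, seen
    here as j + 1 = i + (j + 1 - i), adds the parameters x and y. *)
Lemma binomial_like_conv e x y mu c d :
  binomial_like e x mu c -> binomial_like e y mu d ->
  binomial_like e (x + y) mu (fun j => \sum_(i < j.+1) c i * d (j - i)%N).
Proof.
move=> [c0 c1 cS] [d0 d1 dS]; split=> [k||j].
- by apply: sumr_ge0 => i _; rewrite mulr_ge0.
- by rewrite big_ord_recl big_ord0 addr0 subnn mulr_ile1.
have -> : j.+1%:R * (\sum_(i < j.+2) c i * d (j.+1 - i)%N) =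
  \sum_(i < j.+1) i.+1%:R * c i.+1 * d (j - i)%N +
  \sum_(i < j.+1) c i * ((j - i).+1%:R * d (j - i).+1).
  transitivity (\sum_(i < j.+2) i%:R * c i * d (j.+1 - i)%N +
                \sum_(i < j.+2) c i * ((j.+1 - i)%N%:R * d (j.+1 - i)%N)).
    rewrite -big_split mulr_sumr; apply: eq_bigr => i _ /=.
    rewrite natrB ?leq_ord//; ring.
  congr (_ + _).
    by rewrite big_ord_recl !mul0r add0r.
  rewrite big_ord_recr/= subnn mul0r mulr0 addr0; apply: eq_bigr => i _.
  by rewrite subSn ?leq_ord.
rewrite -big_split mulr_sumr; apply: ler_sum => i _ /=.
have := cS i; have := dS (j - i)%N.
move=> /(ler_wpM2l (c0 i)) h1 /(ler_wpM2r (d0 (j - i)%N)) h2.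
apply: le_trans (lerD h2 h1) _.
rewrite le_eqVlt; apply/orP; left; apply/eqP.
rewrite natrB ?leq_ord//; ring.
Qed.

Lemma binomial_like_prod (I : finType) e (x : I -> R) mu (P : I -> {poly R}) :
  (forall l, binomial_like e (x l) mu (fun k => (P l)`_k)) ->
  binomial_like e (\sum_l x l) mu (fun k => (\prod_l P l)`_k).
Proof.
move=> h; elim/big_rec2 : _ => [|l Q y _ [hQ0 hQ1 hQS]].
  split=> [k||k]; rewrite ?coef1 ?ler0n//.
  by case: k => [|k] /=; rewrite !(mulr0, addr0, mul0r).
have := binomial_like_conv (h l) (And3 hQ0 hQ1 hQS).
by move=> [a b c]; split=> [k||k]; rewrite !coefM.
Qed.

Lemma binomial_like_le e x mu c j : binomial_like e x mu c -> 0 <= e ->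
  (forall i, (i < j)%N -> 0 <= x + mu * i%:R) ->
  c j <= e ^+ j * \prod_(i < j) ((x + mu * i%:R) / i.+1%:R).
Proof.
move=> [c0 c1 cS] e0; elim: j => [|j IH] h; first by rewrite big_ord0 mulr1.
have hj : 0 <= x + mu * j%:R by apply: h.
rewrite big_ord_recr/= exprS.
have {}IH := IH (fun i ij => h i (ltnW ij)).
have : c j.+1 <= e * ((x + mu * j%:R) / j.+1%:R) * c j.
  rewrite -(@ler_pM2l _ j.+1%:R) ?ltr0n//; apply: le_trans (cS j) _.
  rewrite le_eqVlt; apply/orP; left; apply/eqP; field; rewrite nat1r.
  by rewrite pnatr_eq0.
move/le_trans; apply.
have h' : 0 <= e * ((x + mu * j%:R) / j.+1%:R) by rewrite mulr_ge0// divr_ge0.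
apply: le_trans (ler_wpM2l h' IH) _.
by rewrite le_eqVlt; apply/orP; left; apply/eqP; ring.
Qed.

(** Turns a sum over multi-indices with a prescribed total into a coefficient of a product, to which
    [binomial_like_prod] applies. *)
Lemma coef_prod_sumXn (n N : nat) (c : 'I_n -> nat -> R)
    (d : 'I_n -> nat -> nat) j :
  (\prod_(l < n) \sum_(m < N) (c l m)%:P * 'X^(d l m))`_j =
  \sum_(m : {ffun 'I_n -> 'I_N} | \sum_l d l (m l) == j) \prod_l c l (m l).
Proof.
rewrite bigA_distr_bigA/= coef_sum [RHS]big_mkcond/=; apply: eq_bigr => m _.
rewrite big_split/= -rmorph_prod prodrXr coefCM coefXn eq_sym.
by case: eqP; rewrite (mulr1, mulr0).
Qed.

(** Schur test. The arithmetic-geometric inequality bounds twice the (a, b) term by al a * be b * p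
    b ^ 2 + al b * be a * p a ^ 2, whose two halves have equal sums since [r] is symmetric. *)
Lemma schur_sum_le (I : finType) (r : rel I) (p g al be : I -> R) :
  symmetric r -> (forall a, 0 <= al a) -> (forall a, 0 <= be a) ->
  (forall a, g a ^+ 2 = al a * be a) ->
  \sum_a \sum_(b | r a b) p a * g a * (p b * g b) <=
  \sum_a p a ^+ 2 * (be a * \sum_(b | r a b) al b).
Proof.
move=> rC al0 be0 gab; rewrite -(@ler_pM2l _ 2)//.
have -> : 2 * (\sum_a p a ^+ 2 * (be a * \sum_(b | r a b) al b)) =
  \sum_a \sum_(b | r a b) (al a * (p b ^+ 2 * be b) +
                                 al b * (p a ^+ 2 * be a)).
  under [RHS]eq_bigr do rewrite big_split/=.
  rewrite big_split/= [X in X + _](exchange_big_dep xpredT)//=.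
  under [X in X + _]eq_bigr do under eq_bigl do rewrite rC.
  rewrite -mulr2n mulr_natl; congr (_ *+ 2); apply: eq_bigr => a _.
  by rewrite -mulr_suml [RHS]mulrC mulrA.
rewrite mulr_sumr; apply: ler_sum => a _.
rewrite mulr_sumr; apply: ler_sum => b _.
set u := al a * _; set v := al b * _.
have u0 : 0 <= u by rewrite mulr_ge0// mulr_ge0// sqr_ge0.
have v0 : 0 <= v by rewrite mulr_ge0// mulr_ge0// sqr_ge0.
have : (p a * g a * (p b * g b)) ^+ 2 = u * v.
  rewrite !exprMn !gab /u /v; ring.
move: (p a * g a * (p b * g b)) => z hz.
have : (2 * z) ^+ 2 <= (u + v) ^+ 2.
  rewrite exprMn hz -subr_ge0.
  have -> : (u + v) ^+ 2 - 2 ^+ 2 * (u * v) = (u - v) ^+ 2 by ring.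
  exact: sqr_ge0.
by move=> h; rewrite leNgt; apply/negP => lt_uv; nra.
Qed.

End BinomialLike.

(** * Splitting the Mehler coefficients into binomial coefficients *)

Section KeyInequality.
Context {R : rcfType}.
Implicit Types (e x : R) (a b m k : nat).

(** The coefficient of X^k in (1 - X)^(-x); [falling] is the one in (1 + X)^x. *)
Definition rising x k : R := \prod_(i < k) ((x + i%:R) / i.+1%:R).
Definition falling x k : R := \prod_(i < k) ((x - i%:R) / i.+1%:R).

Definition even_diff a m := (m <= a)%N && ~~ odd (a - m).

(* For e = s / (1 + s), the component of exp (- s x^2 / 2) h_a on the m-th
   normalized Hermite function of the variable (1 + s)^(1/2) x, up to a factor
   depending only on s and m. *)
Definition mehler_coef e a m : R :=
  if even_diff a m then
    (- e / 2) ^+ (a - m)./2 / ((a - m)./2)`!%:R * Num.sqrt (a`!%:R / m`!%:R)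
  else 0.

(** With k = (a - m) / 2, this is the coefficient of X^k in (1 - e X)^(-(m + 1) / 2), a series
    attached to m and read along a. [falling_coef] comes from (1 + e X)^(a / 2), attached to a and
    read along m. *)
Definition rising_coef e a m : R :=
  if even_diff a m then
    e ^+ (a - m)./2 * rising (m.+1%:R / 2) (a - m)./2 else 0.

Definition falling_coef e a m : R :=
  if even_diff a m then
    e ^+ (a - m)./2 * falling (a%:R / 2) (a - m)./2 else 0.

Lemma even_diffP a m : reflect (exists k, a = (m + k.*2)%N) (even_diff a m).
Proof.
apply: (iffP andP) => [[ma oam]|[k ->]].
  by exists (a - m)./2; rewrite even_halfK// subnKC.
by rewrite leq_addr addKn odd_double.
Qed.

Lemma half_diff m k : ((m + k.*2) - m)./2 = k.
Proof. by rewrite addKn doubleK. Qed.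

Lemma rising_ge0 x k : 0 <= x -> 0 <= rising x k.
Proof. by move=> x0; apply: prodr_ge0 => i _; rewrite divr_ge0// addr_ge0. Qed.

Lemma falling_ge0 a k : (k.*2 <= a)%N -> 0 <= falling (a%:R / 2) k.
Proof.
move=> ka; apply: prodr_ge0 => i _; rewrite divr_ge0// subr_ge0.
rewrite ler_pdivlMr// -natrM ler_nat; have := ltn_ord i; lia.
Qed.

Lemma risingN x k : rising (x + 1) k = falling (x + k%:R) k.
Proof.
rewrite /rising /falling !big_split/=; congr (_ * _).
rewrite [RHS](reindex_inj rev_ord_inj)/=; apply: eq_bigr => i _.
rewrite natrB// -natr1; ring.
Qed.

(** Duplication formula: the numerators (m + 1 + 2 i) / 2 and (m + 2 + 2 i) / 2 interleave to (m + 2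
    k)! / (m! 4^k). *)
Lemma rising_falling_fact m k :
  rising (m.+1%:R / 2) k * rising (m%:R / 2 + 1) k =
  (m + k.*2)`!%:R / (m`!%:R * k`!%:R ^+ 2 * 4 ^+ k) :> R.
Proof.
elim: k => [|k IH].
  rewrite /rising !big_ord0 double0 addn0 fact0 expr0; field.
  by rewrite pnatr_eq0 -lt0n fact_gt0.
rewrite /rising !big_ord_recr/= -/(rising _ _) -/(rising _ _).
rewrite mulrACA IH doubleS !addnS !factS !natrM [4 ^+ k.+1]exprS.
have := fact_gt0 m; have := fact_gt0 k; rewrite -!(ltr0n R).
have : 0 <= k%:R :> R by []. have := exprn_gt0 k (ltr0n R 4).
rewrite -[(m + k.*2).+2%:R]natr1 -[(m + k.*2).+1%:R]natr1 -[k.+1%:R]natr1.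
rewrite -[m.+1%:R]natr1 natrD -muln2 natrM.
move: (4 ^+ k) => q q0 kp k0 m0; field.
by rewrite !gt_eqF//; lra.
Qed.

Lemma mehler_coef_sqr e a m :
  mehler_coef e a m ^+ 2 = rising_coef e a m * falling_coef e a m.
Proof.
rewrite /mehler_coef /rising_coef /falling_coef.
case: (even_diffP a m) => [[k ->]|_]; last by rewrite expr0n mul0r.
rewrite half_diff exprMn sqr_sqrtr; last by rewrite divr_ge0.
have -> : (m + k.*2)%:R / 2 = m%:R / 2 + k%:R :> R.
  by rewrite natrD -muln2 natrM; field.
rewrite -risingN.
rewrite [RHS]mulrACA rising_falling_fact.
have -> : (4 : R) = 2 * 2 by rewrite -natrM.
have := fact_gt0 m; have := fact_gt0 k; rewrite -!(ltr0n R).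
have := exprn_gt0 k (ltr0n R 2).
rewrite -mulN1r -[-1 * e / 2]mulrA !exprMn !exprVn sqrr_sign.
move: (2 ^+ k) => q q0 k0 m0; field.
by rewrite !gt_eqF.
Qed.

Lemma rising_coef_ge0 e a m : 0 <= e -> 0 <= rising_coef e a m.
Proof.
move=> e0; rewrite /rising_coef; case: ifP => // _.
by rewrite mulr_ge0 ?exprn_ge0// rising_ge0// divr_ge0.
Qed.

Lemma falling_coef_ge0 e a m : 0 <= e -> 0 <= falling_coef e a m.
Proof.
move=> e0; rewrite /falling_coef; case: even_diffP => // -[k ->].
by rewrite mulr_ge0 ?exprn_ge0// falling_ge0// half_diff leq_addl.
Qed.

Lemma coef_sum_even_diffl N m (d : nat -> R) k :
  (\sum_(b < N) (if even_diff b m then d b else 0)%:P * 'X^((b - m)./2))`_k =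
  if (m + k.*2 < N)%N then d (m + k.*2)%N else 0.
Proof.
rewrite coef_sum; case: ifPn => [mkN|mkN].
  rewrite (bigD1 (Ordinal mkN))//= big1 ?addr0 => [|b nb]; rewrite coefCM coefXn.
    by rewrite half_diff eqxx mulr1; case: even_diffP => // -[]; exists k.
  case: even_diffP => [[j bE]|_]; last by rewrite mul0r.
  rewrite bE half_diff; case: eqP => [kj|_]; last by rewrite mulr0.
  by move: nb; rewrite -(inj_eq val_inj)/= bE kj eqxx.
apply: big1 => b _; rewrite coefCM coefXn.
case: even_diffP => [[j bE]|_]; last by rewrite mul0r.
rewrite bE half_diff; case: eqP => [kj|_]; last by rewrite mulr0.
by move: mkN; rewrite kj -bE ltn_ord.
Qed.

Lemma coef_sum_even_diffr N a (d : nat -> R) k : (a < N)%N ->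
  (\sum_(m < N) (if even_diff a m then d m else 0)%:P * 'X^((a - m)./2))`_k =
  if (k.*2 <= a)%N then d (a - k.*2)%N else 0.
Proof.
move=> aN; rewrite coef_sum; case: ifPn => [ka|ka].
  have mN : (a - k.*2 < N)%N by rewrite (leq_ltn_trans _ aN)// leq_subr.
  have aE : a = ((a - k.*2) + k.*2)%N by rewrite subnK.
  rewrite (bigD1 (Ordinal mN))//= big1 ?addr0 => [|b nb]; rewrite coefCM coefXn.
    rewrite {4}aE half_diff eqxx mulr1; case: even_diffP => // -[].
    by exists k.
  case: even_diffP => [[j bE]|_]; last by rewrite mul0r.
  rewrite bE half_diff; case: eqP => [kj|_]; last by rewrite mulr0.
  by move: nb; rewrite -(inj_eq val_inj)/= bE kj addnK eqxx.
apply: big1 => b _; rewrite coefCM coefXn.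
case: even_diffP => [[j bE]|_]; last by rewrite mul0r.
rewrite bE half_diff; case: eqP => [kj|_]; last by rewrite mulr0.
by move: ka; rewrite kj bE leq_addl.
Qed.

Lemma binomial_like0 e mu (c : nat -> R) : 0 <= c 0%N <= 1 ->
  (forall k, c k.+1 = 0) -> binomial_like e 0 mu c.
Proof.
move=> /andP[c0 c1] cS; split=> // -[|k]; rewrite ?cS//.
- by rewrite mulr0n !mulr0 addr0 mulr0 mul0r.
- by rewrite !mulr0.
Qed.

Lemma coef_sum_rising e m N k :
  (\sum_(b < N) (rising_coef e b m)%:P * 'X^((b - m)./2))`_k =
  if (m + k.*2 < N)%N then e ^+ k * rising (m.+1%:R / 2) k else 0.
Proof.
by rewrite [LHS](coef_sum_even_diffl _ _ (fun b =>
  e ^+ (b - m)./2 * rising (m.+1%:R / 2) (b - m)./2)) half_diff.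
Qed.

Lemma coef_sum_falling e a N k : (a < N)%N ->
  (\sum_(m < N) (falling_coef e a m)%:P * 'X^((a - m)./2))`_k =
  if (k.*2 <= a)%N then e ^+ k * falling (a%:R / 2) k else 0.
Proof.
move=> aN; rewrite [LHS](coef_sum_even_diffr (fun m =>
  e ^+ (a - m)./2 * falling (a%:R / 2) (a - m)./2))//.
by case: ifP => // ka; rewrite subKn// doubleK.
Qed.

(** Truncation at [N] replaces the tail of the series by 0. The recurrence survives as an
    inequality, which is why [binomial_like] does not ask for equality. *)
Lemma binomial_like_rising e m N : 0 <= e -> binomial_like e (m.+1%:R / 2) 1
  (fun k => (\sum_(b < N) (rising_coef e b m)%:P * 'X^((b - m)./2))`_k).
Proof.
move=> e0; have x0 : 0 <= m.+1%:R / 2 :> R by rewrite divr_ge0.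
split=> [k||k]; rewrite !coef_sum_rising.
- by case: ifP => // _; rewrite mulr_ge0 ?exprn_ge0 ?rising_ge0.
- by case: ifP => // _; rewrite expr0 mul1r /rising big_ord0.
- case: ifPn => [h|_]; last first.
    rewrite mulr0 mulr_ge0// ?mulr_ge0 ?addr_ge0 ?mul1r//.
    by case: ifP => // _; rewrite mulr_ge0 ?exprn_ge0 ?rising_ge0.
  rewrite ifT; last by move: h; rewrite doubleS; lia.
  rewrite exprS /rising big_ord_recr/= -/(rising _ _).
  rewrite le_eqVlt; apply/orP; left; apply/eqP; field.
  by rewrite nat1r pnatr_eq0.
Qed.

Lemma binomial_like_falling e a N : 0 <= e -> (a < N)%N ->
  binomial_like e (a%:R / 2) (-1)
  (fun k => (\sum_(m < N) (falling_coef e a m)%:P * 'X^((a - m)./2))`_k).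
Proof.
move=> e0 aN.
split=> [k||k]; rewrite !coef_sum_falling//.
- by case: ifP => // ka; rewrite mulr_ge0 ?exprn_ge0 ?falling_ge0.
- by rewrite expr0 mul1r /falling big_ord0.
(* The series is cut where a - 2 k would become negative. At the last index kept, a / 2 - k is still
   nonnegative, so the inequality holds with 0 on the left. *)
- case: ifPn => [h|_]; last first.
    rewrite mulr0; case: ifP => [ka|_]; last by rewrite mulr0.
    rewrite mulr_ge0// ?mulr_ge0 ?exprn_ge0 ?falling_ge0//.
    rewrite mulN1r subr_ge0 ler_pdivlMr// -natrM ler_nat; lia.
  have ka : (k.*2 <= a)%N by move: h; rewrite doubleS; lia.
  rewrite ka exprS /falling big_ord_recr/= -/(falling _ _).
  rewrite le_eqVlt; apply/orP; left; apply/eqP; field.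
  by rewrite nat1r pnatr_eq0.
Qed.

Lemma falling_coef0 a m : falling_coef 0 a m = (a == m)%:R.
Proof.
rewrite /falling_coef; case: even_diffP => [[[|k] ->]|].
- by rewrite addn0 subnn eqxx expr0 mul1r /falling big_ord0.
- by rewrite half_diff exprS !mul0r doubleS addnS -addSn eqn_leq leqNgt ltn_addr.
- by case: eqP => // -> []; exists 0%N; rewrite addn0.
Qed.

Lemma mehler_coef0 a m : mehler_coef 0 a m = (a == m)%:R.
Proof.
rewrite /mehler_coef; case: even_diffP => [[[|k] ->]|].
- by rewrite addn0 subnn eqxx expr0 fact0 divr1 mul1r divff ?sqrtr1//.
- by rewrite half_diff exprS oppr0 !mul0r doubleS addnS -addSn eqn_leq leqNgt ltn_addr.
- by case: eqP => // -> []; exists 0%N; rewrite addn0.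
Qed.

End KeyInequality.

(** * The Schur bound at fixed level *)

Section Levels.
Context {R : rcfType} (n N : nat) (S : pred 'I_n) (e : R).
Hypothesis e01 : 0 <= e <= 1.
Notation index := {ffun 'I_n -> 'I_N}.
Implicit Types (a b m : index).

Definition level a : nat := \sum_l a l.
Definition levelin a : nat := \sum_(l | S l) a l.
(** At e = 0 the three coefficient matrices are the identity, so the coordinates outside [S] are
    left untouched. *)
Let es l := if S l then e else 0.
Let es0 l : 0 <= es l. Proof. by rewrite /es; case: ifP; case/andP: e01. Qed.
Let e0 : 0 <= e. Proof. by case/andP: e01. Qed.

Definition half_gap a m := (\sum_l ((a l - m l)./2))%N.

(** Only the m obtained from a by lowering entries in [S] by even amounts contribute, and the
    truncated subtractions of [half_gap] are then exact. *)
Lemma prod_falling_coef_neq0 a m :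
  \prod_l falling_coef (es l) (a l) (m l) != 0 ->
  (level a = level m + (half_gap a m).*2)%N /\
  (levelin a = levelin m + (half_gap a m).*2)%N.
Proof.
move=> /prodf_neq0 h.
have al l : (a l = m l + ((a l - m l)./2).*2 :> nat)%N.
  have := h l isT; rewrite /falling_coef.
  by case: even_diffP => [[k ->]|_]; [rewrite half_diff|rewrite eqxx].
have aS l : ~~ S l -> a l = m l :> nat.
  move=> Sl; have := h l isT; rewrite /es (negbTE Sl) falling_coef0.
  by case: (@eqP _ (a l : nat) (m l)) => [->//|_]; rewrite eqxx.
rewrite /level /levelin /half_gap; split.
  by rewrite -muln2 big_distrl -big_split/=; apply: eq_bigr => l _; rewrite muln2.
rewrite -muln2 big_distrl/= [X in (_ + X)%N](bigID S)/= [X in (_ + (_ + X))%N]big1 ?addn0.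
  by rewrite -big_split/=; apply: eq_bigr => l _; rewrite muln2.
by move=> l /aS ->; rewrite subnn.
Qed.

(** The left side is at most the coefficient of X^j in a product of truncations of (1 - e X)^(-(m l
    + 1) / 2) over l in [S]; the exponents add up to -(levelin m + #|S|) / 2. *)
Lemma sum_rising_coef_le m K j : K = (level m + j.*2)%N ->
  \sum_(b | level b == K) \prod_l rising_coef (es l) (b l) (m l) <=
  e ^+ j * rising ((levelin m + #|S|)%:R / 2) j.
Proof.
move=> KE.
have rge0 b : 0 <= \prod_l rising_coef (es l) (b l) (m l).
  by apply: prodr_ge0 => l _; exact: rising_coef_ge0.
(* When the product is nonzero, level b = K forces half_gap b m = j; the other terms are only
   added. *)
apply: (@le_trans _ _ (\sum_(b | half_gap b m == j)
    \prod_l rising_coef (es l) (b l) (m l))).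
  rewrite big_mkcond [leRHS]big_mkcond/=; apply: ler_sum => b _.
  case: eqP => // [bK|_]; last by case: ifP.
  have [->//|nz] := eqVneq (\prod_l rising_coef (es l) (b l) (m l)) 0; first by case: ifP.
  rewrite ifT//; apply/eqP/double_inj.
  apply: (@addnI (level m)); rewrite -KE -bK /level -muln2 big_distrl/= -big_split/=.
  apply: eq_bigr => l _; rewrite muln2; move/prodf_neq0: nz => /(_ l isT).
  rewrite /rising_coef.
  by case: even_diffP => [[k ->]|_]; [rewrite half_diff|rewrite eqxx].
rewrite -(@coef_prod_sumXn _ _ _ (fun l (b : nat) => rising_coef (es l) b (m l))
  (fun l (b : nat) => ((b - m l)./2))%N).
have h l : binomial_like e (if S l then (m l).+1%:R / 2 else 0) 1 (fun k =>
    (\sum_(b < N) (rising_coef (es l) b (m l))%:P * 'X^((b - m l)./2))`_k).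
  rewrite /es; case: ifP => Sl; first exact: binomial_like_rising.
  apply: binomial_like0 => [|k]; rewrite coef_sum_rising.
    by case: ifP => _; rewrite ?lexx ?ler01// expr0 mul1r /rising big_ord0 lexx ler01.
  by rewrite exprS !mul0r; case: ifP.
have := binomial_like_le (j := j) (binomial_like_prod h) e0 _.
have -> : \sum_l (if S l then (m l).+1%:R / 2 else 0 : R) =
    (levelin m + #|S|)%:R / 2.
  rewrite -big_mkcond/= -mulr_suml -natr_sum; congr (_%:R / _).
  by rewrite -sum1_card -big_split/=; apply: eq_bigr => l _; rewrite addn1.
move=> H; apply: le_trans (H _) _.
  by move=> i _; rewrite mul1r addr_ge0// divr_ge0.
by rewrite ler_wpM2l ?exprn_ge0// /rising; under eq_bigr do rewrite mul1r.
Qed.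

(** Here the factors (1 + e X)^(a l / 2), cut off, combine into the exponent levelin a / 2. *)
Lemma sum_falling_coef_le a j : (j.*2 <= levelin a)%N ->
  \sum_(m | half_gap a m == j) \prod_l falling_coef (es l) (a l) (m l) <=
  e ^+ j * falling ((levelin a)%:R / 2) j.
Proof.
move=> ja.
rewrite -(@coef_prod_sumXn _ _ _ (fun l (m : nat) => falling_coef (es l) (a l) m)
  (fun l (m : nat) => ((a l - m)./2))%N).
have h l : binomial_like e (if S l then (a l)%:R / 2 else 0) (-1) (fun k =>
    (\sum_(m < N) (falling_coef (es l) (a l) m)%:P * 'X^((a l - m)./2))`_k).
  rewrite /es; case: ifP => Sl; first exact: binomial_like_falling.
  apply: binomial_like0 => [|k]; rewrite coef_sum_falling//.
    by rewrite expr0 mul1r /falling big_ord0 lexx ler01.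
  by rewrite exprS !mul0r; case: ifP.
have := binomial_like_le (j := j) (binomial_like_prod h) e0 _.
have -> : \sum_l (if S l then (a l)%:R / 2 else 0 : R) = (levelin a)%:R / 2.
  by rewrite -big_mkcond/= -mulr_suml -natr_sum.
move=> H; apply: le_trans (H _) _.
  move=> i ij; rewrite mulN1r subr_ge0 ler_pdivlMr// -natrM ler_nat.
  by move: ja ij; lia.
by rewrite ler_wpM2l ?exprn_ge0// /falling; under eq_bigr do rewrite mulN1r.
Qed.

(* The factor psi of the diagonal bound, up to (1 - e)^(3/2), for multi-indices
   whose entries in S sum to K. *)
Definition level_weight (K : nat) : R :=
  \sum_(j < K./2.+1) (1 - e) ^+ (K - j.*2) * e ^+ j.*2 *
    (rising ((K - j.*2 + #|S|)%:R / 2) j * falling (K%:R / 2) j).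

(** Expanding the product of sums writes the matrix as the transpose-square of [G] with the
    nonnegative diagonal [D]. The Schur test is applied for each m separately; then the sum over m
    is grouped by [half_gap a m]. *)
Lemma key_inequality (w : 'I_n -> R) (p : index -> R) : (forall l, 0 <= w l) ->
  \sum_a \sum_(b | level b == level a) p a * p b *
    \prod_l (\sum_(m < N) w l * (1 - es l) ^+ m *
       (mehler_coef (es l) (a l) m * mehler_coef (es l) (b l) m)) <=
  \sum_a p a ^+ 2 * ((\prod_l w l) * level_weight (levelin a)).
Proof.
move=> w0.
pose D m := \prod_l (w l * (1 - es l) ^+ (m l)).
pose G a m := \prod_l mehler_coef (es l) (a l) (m l).
pose al b m := \prod_l rising_coef (es l) (b l) (m l).
pose be a m := \prod_l falling_coef (es l) (a l) (m l).
have D0 m : 0 <= D m.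
  apply: prodr_ge0 => l _; rewrite mulr_ge0// exprn_ge0// /es.
  by case: ifP => _; [case/andP: e01; rewrite subr_ge0|rewrite subr0].
have -> : \sum_a \sum_(b | level b == level a) p a * p b *
    \prod_l (\sum_(m < N) w l * (1 - es l) ^+ m *
       (mehler_coef (es l) (a l) m * mehler_coef (es l) (b l) m)) =
  \sum_m D m * \sum_a \sum_(b | level b == level a)
      p a * G a m * (p b * G b m).
  under [RHS]eq_bigr do rewrite mulr_sumr.
  rewrite [RHS]exchange_big/=; apply: eq_bigr => a _.
  under [RHS]eq_bigr do rewrite mulr_sumr.
  rewrite [RHS]exchange_big/=; apply: eq_bigr => b _.
  rewrite bigA_distr_bigA mulr_sumr; apply: eq_bigr => m _.
  by rewrite !big_split/= /D /G big_split/=; ring.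
apply: (@le_trans _ _ (\sum_m D m * \sum_a p a ^+ 2 *
    (be a m * \sum_(b | level b == level a) al b m))).
  apply: ler_sum => m _; rewrite ler_wpM2l//.
  have := @schur_sum_le _ _ (fun a b => level b == level a) p (G ^~ m)
    (al ^~ m) (be ^~ m); apply => [a b|a|a|a].
  - by rewrite eq_sym.
  - by apply: prodr_ge0 => l _; exact: rising_coef_ge0.
  - by apply: prodr_ge0 => l _; exact: falling_coef_ge0.
  - rewrite /G /al /be -prodrXl -big_split/=; apply: eq_bigr => l _.
    exact: mehler_coef_sqr.
under [leLHS]eq_bigr do rewrite mulr_sumr.
rewrite exchange_big/=; apply: ler_sum => a _.
under [leLHS] eq_bigr do rewrite mulrCA.
rewrite -mulr_sumr ler_wpM2l ?sqr_ge0//.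
(* A common bound for [D m] times the row sum over b, valid for all m with half_gap a m = j: both
   depend on m only through levelin m = levelin a - 2 j. *)
pose c j := (\prod_l w l) * (1 - e) ^+ (levelin a - j.*2) *
  (e ^+ j * rising ((levelin a - j.*2 + #|S|)%:R / 2) j).
have c0 j : 0 <= c j.
  have e1 : 0 <= 1 - e by rewrite subr_ge0; case/andP: e01.
  by rewrite mulr_ge0 ?mulr_ge0 ?exprn_ge0 ?rising_ge0 ?divr_ge0 ?prodr_ge0.
have be0 m : 0 <= be a m.
  by apply: prodr_ge0 => l _; exact: falling_coef_ge0.
apply: (@le_trans _ _ (\sum_m \sum_(j < (levelin a)./2.+1 | half_gap a m == j)
    c j * be a m)).
  apply: ler_sum => m _.
  have [->|/[dup] nz /prod_falling_coef_neq0 [E1 E2]] := eqVneq (be a m) 0.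
    by rewrite mul0r mulr0 sumr_ge0// => j _; rewrite mulr0.
  have lt : (half_gap a m < (levelin a)./2.+1)%N.
    by rewrite ltnS E2 halfD odd_double andbF add0n doubleK leq_addl.
  rewrite (big_pred1 (Ordinal lt)); last by move=> j; rewrite /= eq_sym.
  rewrite /= mulrA mulrAC ler_wpM2r//.
  have -> : D m = (\prod_l w l) * (1 - e) ^+ (levelin a - (half_gap a m).*2).
    rewrite /D big_split/=; congr (_ * _).
    rewrite E2 addnK /levelin -prodrXr [RHS]big_mkcond/=.
    by apply: eq_bigr => l _; rewrite /es; case: ifP => // _; rewrite subr0 expr1n.
  rewrite /c ler_wpM2l ?mulr_ge0 ?exprn_ge0 ?prodr_ge0//.
    by rewrite subr_ge0; case/andP: e01.
  have := sum_rising_coef_le E1; rewrite [in X in _ -> X]E2.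
  by rewrite addnK.
rewrite (exchange_big_dep xpredT)//= /level_weight mulr_sumr.
apply: ler_sum => j _.
have ja : (j.*2 <= levelin a)%N by have := ltn_ord j; lia.
rewrite -mulr_sumr; apply: le_trans (ler_wpM2l (c0 j) (sum_falling_coef_le ja)) _.
rewrite /c le_eqVlt; apply/orP; left; apply/eqP.
rewrite -addnn exprD; ring.
Qed.
End Levels.

(** * Bounds on the diagonal factor and on its sum over the Gaussian weights *)

Section LevelWeight.
Context {R : rcfType}.
Implicit Types (K L s j k : nat).

(** The factors (K + 1 - 2 i) / 2 and (K - 2 i) / 2 interleave to (K + 1)! / ((K + 1 - 2 j)! 4^j).
    What remains beside the binomial coefficient is 'C(2 j, j) / 4^j, written as a product. *)
Lemma falling_fallingE K j : (j.*2 <= K)%N ->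
  falling (K.+1%:R / 2) j * falling (K%:R / 2) j =
  'C(K.+1, j.*2)%:R * \prod_(i < j) (i.*2.+1%:R / i.+1.*2%:R) :> R.
Proof.
elim: j => [|j IH] jK; first by rewrite /falling !big_ord0 bin0 !mulr1.
have {}jK : (j.*2.+2 <= K)%N by rewrite -doubleS.
have {}IH := IH (ltnW (ltnW jK)).
rewrite /falling !big_ord_recr/= -/(falling _ _) -/(falling _ _) mulrACA IH.
have b1 := mul_bin_left K.+1 j.*2; have b2 := mul_bin_left K.+1 j.*2.+1.
move: b1 b2 => /(congr1 (fun k => k%:R : R)) b1 /(congr1 (fun k => k%:R : R)) b2.
move: b1 b2; rewrite !natrM doubleS => b1 b2.
rewrite -['C(K.+1, j.*2.+2)%:R](@mulKf _ j.*2.+2%:R) ?pnatr_eq0// b2.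
rewrite -['C(K.+1, j.*2.+1)%:R](@mulKf _ j.*2.+1%:R) ?pnatr_eq0// b1.
rewrite subSS !natrB; [|lia|lia].
rewrite -muln2 -[K.+1%:R]natr1 -[(j * 2).+2%:R]natr1 -[(j * 2).+1%:R]natr1.
rewrite -[j.+1%:R]natr1 natrM.
move: ('C(_, _)%:R) (\prod_(i < j) _) => c p; field.
have j0 : 0 <= j%:R :> R by [].
by rewrite !gt_eqF//; lra.
Qed.

(** Induction on the squared inequality, from (2 j + 1) (2 j + 3) <= (2 j + 2)^2. The form 1 / sqrt
    (2 j + 1) is the even-index case of 1 / sqrt (i + 1), the factor in the full binomial sums
    below. *)
Lemma central_binomial_le j :
  \prod_(i < j) (i.*2.+1%:R / i.+1.*2%:R) <= (Num.sqrt j.*2.+1%:R)^-1 :> R.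
Proof.
set p := \prod_(i < j) _.
have p0 : 0 <= p by apply: prodr_ge0 => i _; rewrite divr_ge0.
have h : p ^+ 2 <= j.*2.+1%:R^-1.
  rewrite {p0}/p; elim: j => [|j IH]; first by rewrite big_ord0 expr1n invr1.
  rewrite big_ord_recr/= exprMn.
  apply: le_trans (ler_wpM2r (sqr_ge0 _) IH) _.
  rewrite doubleS -muln2 -[(j * 2).+3%:R]natr1 -[(j * 2).+2%:R]natr1.
  rewrite -[(j * 2).+1%:R]natr1 natrM.
  have : 0 <= j%:R :> R by []; move: (j%:R) => x x0.
  rewrite -subr_ge0; set lhs := (X in 0 <= X).
  have -> : lhs = ((x * 2 + 1 + 1 + 1) * (x * 2 + 1 + 1) ^+ 2)^-1.
    by rewrite /lhs; field; rewrite !gt_eqF//; lra.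
  by rewrite invr_ge0 mulr_ge0 ?exprn_ge0//; lra.
rewrite -sqrtrV// -[p]ger0_norm// -sqrtr_sqr; exact: ler_wsqrtr.
Qed.

(** Up to (1 + x)^L, the left side is the mean of 1 / sqrt (i + 1) under the binomial law with
    parameter x / (1 + x). It is at most the square root of the mean of 1 / (i + 1), which [t]
    dominates. This is the bound used for small s. *)
Lemma sum_bin_inv_sqrt_le L (x : R) : 0 < x ->
  \sum_(i < L.+1) 'C(L, i)%:R * x ^+ i / Num.sqrt i.+1%:R <=
  (1 + x) ^+ L * Num.sqrt ((1 + x) / (L.+1%:R * x)).
Proof.
move=> x0; set t := Num.sqrt _.
have t0 : 0 < t by rewrite sqrtr_gt0 divr_gt0 ?mulr_gt0//; lra.
have tt : t ^+ 2 = (1 + x) / (L.+1%:R * x).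
  by rewrite sqr_sqrtr// divr_ge0 ?mulr_ge0//; lra.
(* AM-GM with weight t, then [C(L, i) / (i + 1) = C(L + 1, i + 1) / (L + 1)] *)
apply: (@le_trans _ _ (\sum_(i < L.+1) 'C(L, i)%:R * x ^+ i *
    ((t + (t * i.+1%:R)^-1) / 2))).
  apply: ler_sum => i _; apply: ler_wpM2l; first by rewrite mulr_ge0 ?exprn_ge0// ltW.
  have i0 : 0 < i.+1%:R :> R by [].
  have q0 : 0 < Num.sqrt i.+1%:R :> R by rewrite sqrtr_gt0.
  have qq : Num.sqrt i.+1%:R ^+ 2 = i.+1%:R :> R by rewrite sqr_sqrtr// ltW.
  rewrite -[X in t * X]qq; move: (Num.sqrt i.+1%:R) q0 => q q0; rewrite -subr_ge0.
  have -> : (t + (t * q ^+ 2)^-1) / 2 - q^-1 = (t * q - 1) ^+ 2 / (2 * t * q ^+ 2).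
    by field; rewrite !gt_eqF.
  by rewrite divr_ge0 ?sqr_ge0 ?mulr_ge0 ?exprn_ge0// ltW.
have e1 : \sum_(i < L.+1) 'C(L, i)%:R * x ^+ i = (1 + x) ^+ L.
  rewrite exprDn; apply: eq_bigr => i _.
  by rewrite expr1n mul1r mulr_natl.
have e2 : \sum_(i < L.+1) 'C(L, i)%:R * x ^+ i / i.+1%:R <=
    (1 + x) ^+ L * t ^+ 2.
  rewrite tt mulrA -exprSr ler_pdivlMr ?mulr_gt0// exprDn mulr_suml.
  rewrite [leRHS]big_ord_recl/= -[leLHS]add0r; apply: lerD.
    by rewrite expr1n mul1r expr0 mulrn_wge0.
  rewrite le_eqVlt; apply/orP; left; apply/eqP; apply: eq_bigr => i _.
  rewrite expr1n mul1r -[RHS]mulr_natl /bump/= add1n.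
  have /(congr1 (fun k => k%:R : R)) := mul_bin_diag L.+1 i.
  rewrite !natrM => h; rewrite exprS.
  have : ('C(L.+1, i.+1)%:R : R) = L.+1%:R * 'C(L, i)%:R / i.+1%:R.
    by rewrite h [i.+1%:R * _]mulrC mulfK ?pnatr_eq0.
  move=> ->; ring.
have -> : \sum_(i < L.+1) 'C(L, i)%:R * x ^+ i * ((t + (t * i.+1%:R)^-1) / 2) =
    t / 2 * (\sum_(i < L.+1) 'C(L, i)%:R * x ^+ i) +
    (2 * t)^-1 * \sum_(i < L.+1) 'C(L, i)%:R * x ^+ i / i.+1%:R.
  rewrite !mulr_sumr -big_split/=; apply: eq_bigr => i _; field.
  by rewrite nat1r pnatr_eq0 !gt_eqF.
rewrite e1; have t2 : 0 <= (2 * t)^-1 by rewrite invr_ge0 mulr_ge0// ltW.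
apply: le_trans (lerD (lexx _) (ler_wpM2l t2 e2)) _.
rewrite le_eqVlt; apply/orP; left; apply/eqP; field.
by rewrite gt_eqF.
Qed.

(** Holds term by term, because K + 1 <= (i + 1) (K + 1 - i)^2 for i <= K. Lowering the power of 1 +
    x to K leaves the decay (1 + s)^(-3/2) intact for large s. *)
Lemma sum_bin_inv_sqrt_le2 K (x : R) : 0 <= x ->
  \sum_(i < K.+1) 'C(K.+1, i)%:R * x ^+ i / Num.sqrt i.+1%:R <=
  Num.sqrt K.+1%:R * (1 + x) ^+ K.
Proof.
move=> x0; rewrite exprDn mulr_sumr; apply: ler_sum => i _.
rewrite expr1n mul1r -[X in _ <= _ * X]mulr_natl mulrAC [leRHS]mulrA ler_wpM2r ?exprn_ge0//.
rewrite ler_pdivrMr ?sqrtr_gt0// mulrAC -sqrtrM// -natrM.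
have iK : (i <= K)%N by rewrite -ltnS.
have /(congr1 (fun k => k%:R : R)) := mul_bin_down K.+1 i.
rewrite !natrM /= => h.
have -> : 'C(K.+1, i)%:R = K.+1%:R * 'C(K, i)%:R / (K.+1 - i)%:R :> R.
  by rewrite h [(_ - _)%:R * _]mulrC mulfK// pnatr_eq0 subn_eq0 -ltnNge.
rewrite ler_pdivrMr; last by rewrite ltr0n subn_gt0.
rewrite mulrAC ler_wpM2r//.
rewrite -[leLHS]ger0_norm// -sqrtr_sqr -[(K.+1 - i)%:R]ger0_norm// -sqrtr_sqr.
rewrite -sqrtrM ?mulr_ge0//; apply: ler_wsqrtr; rewrite -!natrX -!natrM ler_nat.
rewrite -mulnn -mulnA leq_mul2l /=.
by rewrite subSn// -{1}(subnKC iK) -mulnn; nia.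
Qed.


(* The two bounds cross at s = L, where each of the two partial sums is O(1). *)
Lemma sum_decay_le L (psi : nat -> R) T : (0 < L)%N -> psi 0%N <= 1 ->
  (forall s, psi s.+1 <= (Num.sqrt (L%:R * s.+1%:R))^-1) ->
  (forall s, psi s <= Num.sqrt L%:R / Num.sqrt s.+1%:R ^+ 3) ->
  \sum_(s < T) psi s <= 5.
Proof.
move=> L0 p0 p1 p2.
pose q (s : nat) := Num.sqrt s%:R : R.
have qE s : Num.sqrt s%:R = q s by [].
have q0 s : 0 < q s.+1 by rewrite sqrtr_gt0.
have qge0 s : 0 <= q s by exact: sqrtr_ge0.
have qq s : q s ^+ 2 = s%:R by rewrite sqr_sqrtr.
have qS s : q s.+1 ^+ 2 = q s ^+ 2 + 1 by rewrite !qq natr1.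
have qL : 0 < q L by case: L L0 {p1 p2}.
have qle s : q s <= q s.+1 by apply: ler_wsqrtr; rewrite ler_nat.
have dq s : q s.+1 - q s = (q s.+1 + q s)^-1.
  have ne : q s.+1 + q s != 0 by rewrite gt_eqF// ltr_wpDr.
  by apply: (mulIf ne); rewrite mulVf// -subr_sqr qS addrAC subrr add0r.
(* Telescoping form of the first bound: 1 / sqrt (s + 1) <= 2 (sqrt (s + 1) - sqrt s). *)
have psi1 s : psi s.+1 <= 2 / q L * (q s.+1 - q s).
  apply: le_trans (p1 s) _; rewrite sqrtrM// !qE dq -subr_ge0.
  have := qle s; have := q0 s; have := qge0 s.
  move: (q s) (q s.+1) (q L) qL => x y z z0 x0 y0 xy.
  rewrite (_ : _ - _ = (y - x) / (z * y * (y + x))).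
    by rewrite divr_ge0 ?subr_ge0// !mulr_ge0 ?addr_ge0// ltW.
  by field; rewrite !gt_eqF// ltr_wpDr.
(* Likewise (s + 2)^(-3/2) <= 2 ((s + 1)^(-1/2) - (s + 2)^(-1/2)). *)
have psi2 s : psi s.+1 <= 2 * q L * ((q s.+1)^-1 - (q s.+2)^-1).
  apply: le_trans (p2 s.+1) _; rewrite !qE -subr_ge0.
  have d := dq s.+1; have ne : q s.+2 + q s.+1 != 0 by rewrite gt_eqF// addr_gt0.
  have -> : (q s.+1)^-1 - (q s.+2)^-1 = (q s.+1 * q s.+2 * (q s.+2 + q s.+1))^-1.
    rewrite invfM -d; field.
    by rewrite !gt_eqF.
  have := qle s.+1; have := q0 s.+1; have := q0 s.
  move: (q s.+1) (q s.+2) (q L) qL => x y z z0 x0 y0 xy.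
  rewrite (_ : _ - _ = z * ((y - x) * (2 * y + x)) / (x * y ^+ 3 * (y + x))).
    by rewrite divr_ge0 ?mulr_ge0 ?subr_ge0 ?exprn_ge0 ?addr_ge0 ?mulr_ge0// ltW.
  by field; rewrite !gt_eqF// addr_gt0.
have A t : (t <= L)%N -> \sum_(s < t.+1) psi s <= 1 + 2 / q L * q t.
  elim: t => [_|t IH tL].
    by rewrite big_ord1 (le_trans p0)// lerDl mulr_ge0 ?divr_ge0// ltW.
  rewrite big_ord_recr/=; apply: le_trans (lerD (IH (ltnW tL)) (psi1 t)) _.
  by rewrite le_eqVlt; apply/orP; left; apply/eqP; ring.
(* The 3 is [A] at t = L, that is 1 + 2. The tail adds at most 2 q L / q (L + 1) <= 2, whence 5. *)
have B d : \sum_(s < L.+1 + d) psi s <= 3 + 2 * q L * ((q L.+1)^-1 - (q (L.+1 + d)%N)^-1).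
  elim: d => [|d IH].
    rewrite addn0 subrr mulr0 addr0; apply: le_trans (A L (leqnn _)) _.
    by rewrite divfK ?gt_eqF//; lra.
  rewrite addnS big_ord_recr/= addSn; apply: le_trans (lerD IH (psi2 _)) _.
  by rewrite addSn le_eqVlt; apply/orP; left; apply/eqP; ring.
have [TL|LT] := leqP T L.+1.
  case: T TL => [|T] TL; first by rewrite big_ord0.
  apply: le_trans (A _ TL) _.
  have : q T <= q L by apply: ler_wsqrtr; rewrite ler_nat.
  have : 0 <= 2 / q L by rewrite divr_ge0// ltW.
  move=> /ler_wpM2l h /h; rewrite divfK ?gt_eqF//; lra.
rewrite -(subnKC (ltnW LT)); apply: le_trans (B _) _.
have h1 : q L / q L.+1 <= 1 by rewrite ler_pdivrMr// mul1r.
have : 0 <= q L / q (L.+1 + (T - L.+1))%N by rewrite divr_ge0.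
move: (q (_ + _)%N) => x; nra.
Qed.


Lemma sum_double_le K (F : nat -> R) : (forall i, 0 <= F i) ->
  \sum_(j < K./2.+1) F j.*2 <= \sum_(i < K.+1) F i.
Proof.
move=> F0.
have h k : \sum_(j < k.+1) F j.*2 <= \sum_(i < k.*2.+1) F i.
  elim: k => [|k IH]; first by rewrite !big_ord1.
  rewrite doubleS [leLHS]big_ord_recr [leRHS]big_ord_recr/= lerD//.
  by rewrite [leRHS]big_ord_recr/= ler_wpDr.
apply: le_trans (h _) _.
rewrite -[K in leRHS]odd_double_half; case: odd; rewrite ?add0n// add1n.
by rewrite [leRHS]big_ord_recr lerDl.
Qed.

(** Since (K - 2 j + 3) / 2 - 1 + j = (K + 1) / 2, the rising factor is a falling one that starts
    half a unit above the other, as [falling_fallingE] requires. The terms obtained are the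
    even-index ones of the sum on the right. *)
Lemma level_weight_le n (S : pred 'I_n) K (x : R) : #|S| = 3%N -> 0 <= x ->
  level_weight S (x / (1 + x)) K <=
  (\sum_(i < K.+1) 'C(K.+1, i)%:R * x ^+ i / Num.sqrt i.+1%:R) / (1 + x) ^+ K.
Proof.
move=> S3 x0; have x1 : 0 < 1 + x by lra.
pose F i : R := 'C(K.+1, i)%:R * x ^+ i / Num.sqrt i.+1%:R / (1 + x) ^+ K.
have F0 i : 0 <= F i.
  by rewrite divr_ge0 ?exprn_ge0 ?divr_ge0 ?mulr_ge0 ?exprn_ge0 ?sqrtr_ge0// ltW.
rewrite mulr_suml; apply: le_trans (sum_double_le _ F0).
apply: ler_sum => j _; have jK : (j.*2 <= K)%N by have := ltn_ord j; lia.
have -> : rising ((K - j.*2 + #|S|)%:R / 2) j = falling (K.+1%:R / 2) j :> R.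
  rewrite -[X in falling X](subrK j%:R) -risingN; congr (rising _ _).
  by rewrite S3 natrD natrB// -muln2 natrM -natr1; field.
rewrite falling_fallingE// /F.
have -> : 1 - x / (1 + x) = (1 + x)^-1 by field; rewrite gt_eqF.
rewrite (_ : _ ^+ _ * _ ^+ _ = x ^+ j.*2 / (1 + x) ^+ K); last first.
  by rewrite exprVn expr_div_n mulrCA -invfM -exprD subnK.
rewrite (_ : _ * (_ * _) = 'C(K.+1, j.*2)%:R * x ^+ j.*2 / (1 + x) ^+ K *
  \prod_(i < j) (i.*2.+1%:R / i.+1.*2%:R)); last by ring.
rewrite [leRHS]mulrAC ler_wpM2l ?divr_ge0 ?mulr_ge0 ?exprn_ge0 ?(ltW x1)//.
exact: central_binomial_le.
Qed.

Lemma sum_level_weight_le n (S : pred 'I_n) K T : #|S| = 3%N ->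
  \sum_(s < T) Num.sqrt (1 + s%:R)^-1 ^+ 3 *
     level_weight S (s%:R / (1 + s%:R)) K <= 5 :> R.
Proof.
move=> S3; apply: (@sum_decay_le K.+1 (fun s => (Num.sqrt (1 + s%:R)^-1 : R) ^+ 3 *
     level_weight S (s%:R / (1 + s%:R)) K)) => // [|s|s].
- rewrite addr0 invr1 sqrtr1 expr1n mul1r mul0r /level_weight.
  rewrite big_ord_recl big1 => [|j _]; last by rewrite doubleS expr0n mulr0 mul0r.
  by rewrite subr0 expr1n expr0 /rising /falling !big_ord0 !mulr1 addr0.
- apply: le_trans (ler_wpM2l _ (level_weight_le K S3 _)) _ => //.
  rewrite mulrA; have s0 : 0 < s.+1%:R :> R by [].
  have s1 : 0 < 1 + s.+1%:R :> R by rewrite addr_gt0.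
  rewrite ler_pdivrMr ?exprn_gt0//.
  (* Adding the term i = K + 1 completes the sum to that of [sum_bin_inv_sqrt_le] at K + 1. *)
  apply: (@le_trans _ _ (Num.sqrt (1 + s.+1%:R)^-1 ^+ 3 *
    ((1 + s.+1%:R) ^+ K.+1 * Num.sqrt ((1 + s.+1%:R) / (K.+2%:R * s.+1%:R))))).
    rewrite ler_wpM2l ?exprn_ge0 ?sqrtr_ge0//.
    apply: le_trans (sum_bin_inv_sqrt_le K.+1 s0).
    by rewrite [leRHS]big_ord_recr/= lerDl divr_ge0 ?mulr_ge0 ?exprn_ge0 ?sqrtr_ge0.
  rewrite sqrtrV ?(ltW s1)// [Num.sqrt (_ / _)]sqrtrM ?(ltW s1)// sqrtrV ?mulr_ge0//.
  set q := Num.sqrt (1 + _).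
  have q0 : 0 < q by rewrite sqrtr_gt0.
  have -> : 1 + s.+1%:R = q ^+ 2 by rewrite sqr_sqrtr// ltW.
  rewrite (_ : _ * _ = (Num.sqrt (K.+2%:R * s.+1%:R))^-1 * (q ^+ 2) ^+ K); last first.
    rewrite [(q ^+ 2) ^+ K.+1]exprS; move: ((q ^+ 2) ^+ K) => z; field.
    by rewrite !gt_eqF// sqrtr_gt0 mulr_gt0.
  rewrite ler_wpM2r ?exprn_ge0 ?(ltW q0)//.
  rewrite lef_pV2 ?posrE ?sqrtr_gt0 ?mulr_gt0//.
  by apply: ler_wsqrtr; rewrite ler_wpM2r// ler_nat.
- apply: le_trans (ler_wpM2l _ (level_weight_le K S3 _)) _ => //.
  have s0 : 0 < 1 + s%:R :> R by rewrite ltr_pwDl.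
  apply: (@le_trans _ _ (Num.sqrt (1 + s%:R)^-1 ^+ 3 * Num.sqrt K.+1%:R)).
    rewrite ler_wpM2l ?exprn_ge0 ?sqrtr_ge0// ler_pdivrMr ?exprn_gt0//.
    exact: sum_bin_inv_sqrt_le2.
  by rewrite mulrC sqrtrV ?(ltW s0)// exprVn nat1r.
Qed.

End LevelWeight.

(** * Gaussian integrals and Hermite functions *)

Section GaussianMoments.
Context {R : realType}.
Implicit Types (b x : R) (P Q : {poly R}).
Notation mu := (@lebesgue_measure R).

Definition poly_gauss b P x : R := P.[x] * expR (- (b * x ^+ 2)).

Definition gauss_mean b P : R := \int[mu]_x poly_gauss b P x.

(** Gives access to the integrability and total mass of the normal law of variance 1 / (2 b). *)
Lemma gaussE b x : 0 < b -> expR (- (b * x ^+ 2)) =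
  Num.sqrt (pi / b) * normal_pdf 0 (Num.sqrt (2 * b)^-1) x.
Proof.
move=> b0; have s0 : 0 < (2 * b)^-1 by rewrite invr_gt0; lra.
rewrite normal_pdfE ?gt_eqF ?sqrtr_gt0// /normal_peak /normal_fun.
rewrite sqr_sqrtr ?(ltW s0)// subr0.
have -> : (2 * b)^-1 * pi *+ 2 = pi / b by rewrite -mulr_natl; field; rewrite gt_eqF.
rewrite [RHS]mulrA divff ?mul1r; last by rewrite gt_eqF// sqrtr_gt0 divr_gt0// pi_gt0.
by congr expR; rewrite -mulr_natl; field; rewrite gt_eqF.
Qed.

Lemma integrable_gauss b : 0 < b ->
  mu.-integrable setT (EFin \o (fun x => expR (- (b * x ^+ 2)))).
Proof.
move=> b0.
have := integrableZl measurableT (Num.sqrt (pi / b))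
  (integrable_normal_pdf 0 (Num.sqrt (2 * b)^-1)).
by apply: eq_integrable => // x _ /=; rewrite gaussE// EFinM.
Qed.

Lemma continuous_poly_gauss b P : continuous (poly_gauss b P).
Proof.
move=> x; apply: continuousM; first exact: continuous_horner.
apply: (@continuous_comp _ _ _ (fun x => - (b * x ^+ 2)) expR).
  apply: continuousN; apply: continuousM; first exact: cst_continuous.
  exact: exprn_continuous.
exact: continuous_expR.
Qed.

Lemma measurable_poly_gauss b P : measurable_fun setT (poly_gauss b P).
Proof. by apply: continuous_measurable_fun; exact: continuous_poly_gauss. Qed.

(** Half of the Gaussian exponent is spent on absorbing the polynomial: |z| <= 1 + z^2 leads to an
    even power, and y^k / k! <= exp y does the rest. *)
Lemma abs_monomial_gauss_le b k x : 0 < b ->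
  `|x ^+ k| <= (1 + k`!%:R * (2 / b) ^+ k) * expR (b / 2 * x ^+ 2).
Proof.
move=> b0; set y := b / 2 * x ^+ 2.
have y0 : 0 <= y by rewrite mulr_ge0 ?sqr_ge0// divr_ge0// ltW.
have e1 : 1 <= expR y by rewrite -expR0 ler_expR.
have h : `|x ^+ k| <= 1 + x ^+ k ^+ 2.
  rewrite -[x ^+ k ^+ 2]real_normK ?num_real//.
  by have := normr_ge0 (x ^+ k); move: (`| _ |) => z; nra.
apply: le_trans h _; rewrite mulrDl mul1r lerD//.
have -> : x ^+ k ^+ 2 = (2 / b) ^+ k * y ^+ k.
  by rewrite exprAC -exprMn /y; congr (_ ^+ _); field; rewrite gt_eqF.
rewrite [k`!%:R * _]mulrC -mulrA ler_wpM2l ?exprn_ge0 ?divr_ge0 ?(ltW b0)//.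
rewrite mulrC -ler_pdivrMr ?ltr0n ?fact_gt0//.
case: k => [|k]; first by rewrite expr0 fact0 divr1.
by apply: le_trans (expR_ge1Dxn k y0); rewrite lerDr.
Qed.

Lemma poly_gauss_le b P : 0 < b ->
  exists2 C, 0 <= C & forall x, `|poly_gauss b P x| <= C * expR (- (b / 2 * x ^+ 2)).
Proof.
move=> b0; exists (\sum_(k < size P) `|P`_k| * (1 + k`!%:R * (2 / b) ^+ k)).
  apply: sumr_ge0 => k _; rewrite mulr_ge0// addr_ge0// mulr_ge0//.
  by rewrite exprn_ge0// divr_ge0// ltW.
move=> x; rewrite /poly_gauss normrM [ `|expR _|]ger0_norm ?expR_ge0//.
have -> : - (b * x ^+ 2) = - (b / 2 * x ^+ 2) - b / 2 * x ^+ 2 by field.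
rewrite expRB [leRHS]mulrC mulrCA ler_wpM2l ?expR_ge0// ler_pdivrMr ?expR_gt0//.
rewrite horner_coef (le_trans (ler_norm_sum _ _ _))// mulr_suml.
apply: ler_sum => k _; rewrite normrM -[leRHS]mulrA ler_wpM2l//.
exact: abs_monomial_gauss_le.
Qed.

Lemma integrable_poly_gauss b P : 0 < b ->
  mu.-integrable setT (EFin \o poly_gauss b P).
Proof.
move=> b0; have [C C0 hC] := poly_gauss_le P b0.
have b2 : 0 < b / 2 by rewrite divr_gt0.
apply: (le_integrable _ _ _ (integrableZl measurableT C (integrable_gauss b2))) => //.
  by apply/measurable_EFinP; exact: measurable_poly_gauss.
move=> x _ /=; rewrite lee_fin (le_trans (hC x))//.
by rewrite ger0_norm ?mulr_ge0 ?expR_ge0.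
Qed.

Lemma is_derive_poly_gauss b P x : is_derive x 1 (poly_gauss b P)
  (poly_gauss b (P^`() - (2 * b) *: ('X * P)) x).
Proof.
have h : is_derive x 1 (fun x => expR (- (b * x ^+ 2)))
    (- (2 * b * x) * expR (- (b * x ^+ 2))).
  have -> : (fun x => expR (- (b * x ^+ 2))) = expR \o (fun x => - (b * x ^+ 2)) by [].
  apply: is_derive_eq; rewrite /GRing.scale/=; ring.
rewrite /poly_gauss; apply: is_derive_eq.
rewrite /GRing.scale/= hornerD hornerN hornerZ hornerM hornerX; ring.
Qed.

Lemma cvg_poly_gauss_symmetric b P : 0 < b ->
  poly_gauss b P n.+1%:R - poly_gauss b P (- n.+1%:R) @[n --> \oo] --> (0 : R).
Proof.
move=> b0; have [C C0 hC] := poly_gauss_le P b0.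
pose q := expR (- (b / 2)).
have q1 : `|q| < 1 by rewrite ger0_norm ?expR_ge0// expR_lt1 oppr_lt0 divr_gt0.
have hq n : expR (- (b / 2 * n.+1%:R ^+ 2)) <= q ^+ n.
  rewrite -expRM_natl ler_expR mulrN lerN2 mulrC ler_wpM2l ?divr_ge0 ?(ltW b0)//.
  by rewrite -natrX ler_nat -mulnn; lia.
apply/norm_cvg0P.
apply: (@squeeze_cvgr _ _ _ _ (cst 0) (fun n => 2 * C * q ^+ n)).
- apply: nearW => n; rewrite normr_ge0/=.
  apply: le_trans (ler_normB _ _) _.
  apply: le_trans (lerD (hC _) (hC _)) _.
  by rewrite sqrrN -mulr2n -[leLHS]mulr_natl [leLHS]mulrA ler_wpM2l ?mulr_ge0.
- exact: cvg_cst.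
- rewrite -[0](mulr0 (2 * C)); apply: cvgMl_tmp; exact: cvg_expr.
Qed.

(** Integration by parts: the integrand is the derivative of [poly_gauss b P], whose boundary values
    vanish at infinity. *)
Lemma gauss_mean_total_derivative b P : 0 < b ->
  gauss_mean b (P^`() - (2 * b) *: ('X * P)) = 0.
Proof.
move=> b0; set Q := _ - _.
pose I n := [set` `[(- n.+1%:R : R), n.+1%:R]].
pose g n x := ((poly_gauss b Q \_ (I n)) x)%:E.
have gE n : (\int[mu]_x g n x)%E =
    (poly_gauss b P n.+1%:R - poly_gauss b P (- n.+1%:R))%:E.
  have dP x := is_derive_poly_gauss b P x.
  have cP := @continuous_poly_gauss b P.
  rewrite EFinB -(@continuous_FTC2 _ (poly_gauss b Q)).
  - rewrite [RHS]integral_mkcond; apply: eq_integral => x _.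
    by rewrite /g restrict_EFin.
  - by rewrite -subr_gt0 opprK addr_gt0.
  - by apply: continuous_subspaceT; exact: continuous_poly_gauss.
  - split => [x _||].
    + exact: ex_derive.
    + exact/cvg_at_right_filter/cP.
    + exact/cvg_at_left_filter/cP.
  - by move=> x _; rewrite derive1E derive_val.
have iQ := integrable_poly_gauss Q b0.
have mI n : measurable (I n) by exact: measurable_itv.
have cg : (\int[mu]_x g n x)%E @[n --> \oo] --> (\int[mu]_x (poly_gauss b Q x)%:E)%E.
  apply: (@dominated_cvg _ _ _ mu setT measurableT _ _
    (fun x => `|(poly_gauss b Q x)%:E|%E)) => //.
  - move=> n; apply/measurable_EFinP; apply/(measurable_restrictT _ (mI n)).
    by apply: measurable_funS (measurable_poly_gauss b Q).
  - move=> x _; apply: cvg_near_cst.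
    near=> n; rewrite /g patchE mem_set// /I/= in_itv/= -ler_norml.
    near: n; exists (Num.truncn `|x|) => // n /= xn.
    by rewrite (le_trans (ltW (truncnS_gt _)))// ler_nat.
  - exact: integrable_abse.
  - move=> n x _; rewrite /g patchE; case: ifP => _ //.
    by rewrite abse0.
suff : (gauss_mean b Q)%:E = 0%:E by case.
rewrite /gauss_mean /Rintegral fineK; last exact: integrable_fin_num.
apply: (cvg_unique _ cg) => //.
apply: cvg_EFin; first by apply: nearW => n; rewrite gE.
have -> : fine \o (fun n => \int[mu]_x g n x)%E =
  (fun n => poly_gauss b P n.+1%:R - poly_gauss b P (- n.+1%:R)).
  by apply/funext => n; rewrite /comp gE.
exact: cvg_poly_gauss_symmetric.
Unshelve. all: by end_near.
Qed.

Lemma gauss_mean_linear b c P Q : 0 < b ->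
  gauss_mean b (c *: P + Q) = c * gauss_mean b P + gauss_mean b Q.
Proof.
move=> b0; rewrite /gauss_mean -RintegralZl//; last exact: integrable_poly_gauss.
rewrite -RintegralD//; last 2 first.
- by have := integrableZl measurableT c (integrable_poly_gauss P b0).
- exact: integrable_poly_gauss.
apply: eq_Rintegral => x _.
by rewrite /= /poly_gauss hornerD hornerZ mulrDl -mulrA.
Qed.

Lemma gauss_mean1 b : 0 < b -> gauss_mean b 1 = Num.sqrt (pi / b).
Proof.
move=> b0; rewrite /gauss_mean /Rintegral.
under eq_integral do rewrite /poly_gauss hornerE mul1r gaussE// EFinM.
rewrite integralZl//; last exact: integrable_normal_pdf.
by rewrite integral_normal_pdf mule1.
Qed.

End GaussianMoments.

(** * Hermite polynomials and their change of scale *)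

Section HermitePolynomials.
Context {R : realType}.
Implicit Types (s b x : R) (P Q : {poly R}) (a m k : nat).

(* Monic orthogonal polynomials of the weight exp (- x^2 / s). *)
Fixpoint hpoly s a : {poly R} :=
  if a is a'.+1 then 'X * hpoly s a' - (s / 2) *: (hpoly s a')^`() else 1.

Lemma deriv_hpoly s a : (hpoly s a)^`() = a%:R *: hpoly s a.-1.
Proof.
elim: a => [|a IH]; first by rewrite derivC scale0r.
rewrite [LHS]/= derivB derivM derivX mul1r derivZ IH derivZ -addrA.
have -> : 'X * (a%:R *: hpoly s a.-1) - (s / 2) *: (a%:R *: (hpoly s a.-1)^`()) =
    a%:R *: hpoly s a.
  case: a {IH} => [|a]; first by rewrite !scale0r scaler0 mulr0 subrr.
  by rewrite -scalerAr [X in _ - X]scalerA [s / 2 * _]mulrC -scalerA -scalerBr.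
by rewrite -[X in X + _]scale1r -scalerDl nat1r.
Qed.

Lemma gauss_meanZ b c P : 0 < b -> gauss_mean b (c *: P) = c * gauss_mean b P.
Proof.
move=> b0; rewrite -[c *: P]addr0 gauss_mean_linear//.
rewrite -[X in _ + gauss_mean b X](scale0r P).
have /(_ (- 1)) h := gauss_mean_linear _ 0 0 b0.
have -> : gauss_mean b (0 *: P) = 0.
  have := gauss_mean_linear (-1) P P b0.
  by rewrite scaleN1r addNr mulN1r addNr scale0r.
by rewrite addr0.
Qed.

Lemma gauss_meanD b P Q : 0 < b ->
  gauss_mean b (P + Q) = gauss_mean b P + gauss_mean b Q.
Proof. by move=> b0; rewrite -[P]scale1r gauss_mean_linear// scale1r mul1r. Qed.

Lemma gauss_meanB b P Q : 0 < b ->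
  gauss_mean b (P - Q) = gauss_mean b P - gauss_mean b Q.
Proof.
by move=> b0; rewrite gauss_meanD// -scaleN1r gauss_meanZ// mulN1r.
Qed.

Lemma gauss_mean_sum (I : Type) (r : seq I) b (F : I -> {poly R}) : 0 < b ->
  gauss_mean b (\sum_(i <- r) F i) = \sum_(i <- r) gauss_mean b (F i).
Proof.
move=> b0; elim: r => [|i r IH]; last by rewrite !big_cons gauss_meanD// IH.
by rewrite !big_nil -(scale0r 0) gauss_meanZ// mul0r.
Qed.

(** The operator X - (s / 2) D that builds [hpoly] is the adjoint of (s / 2) D for the weight exp (-
    x^2 / s). *)
Lemma gauss_mean_hpolyS s a Q : 0 < s ->
  gauss_mean s^-1 (hpoly s a.+1 * Q) =
  s / 2 * gauss_mean s^-1 (hpoly s a * Q^`()).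
Proof.
move=> s0; have b0 : 0 < s^-1 by rewrite invr_gt0.
have := gauss_mean_total_derivative (hpoly s a * Q) b0.
rewrite gauss_meanB// gauss_meanZ// derivM gauss_meanD// => /eqP.
rewrite subr_eq0 => /eqP h; rewrite /= mulrBl gauss_meanB// -scalerAl gauss_meanZ//.
rewrite -['X * _ * _]mulrA; have sn : s != 0 by rewrite gt_eqF.
rewrite -[gauss_mean _ ('X * _)](@mulKf _ (2 * s^-1)) ?mulf_neq0 ?invr_eq0// -h.
by field.
Qed.

Lemma gauss_mean_hpoly s a c : 0 < s ->
  gauss_mean s^-1 (hpoly s a * hpoly s c) =
  if a == c then a`!%:R * (s / 2) ^+ a * Num.sqrt (pi * s) else 0.
Proof.
move=> s0; elim: a c => [|a IH] [|c].
- by rewrite mulr1 gauss_mean1 ?invr_gt0// invrK fact0 !mul1r.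
- rewrite mulrC gauss_mean_hpolyS// derivC mulr0.
  by rewrite -(scale0r 0) gauss_meanZ ?invr_gt0// mul0r mulr0.
- rewrite gauss_mean_hpolyS// derivC mulr0.
  by rewrite -(scale0r 0) gauss_meanZ ?invr_gt0// mul0r mulr0.
- rewrite gauss_mean_hpolyS// deriv_hpoly -scalerAr gauss_meanZ ?invr_gt0// IH.
  rewrite /= eqSS; case: eqP => [<-|_]; last by rewrite !mulr0.
  by rewrite factS natrM exprS /=; ring.
Qed.

(** As [hpoly s a] is exp (- (s / 4) D^2) applied to X^a, [hpoly 1 a] is exp (- ((1 - s) / 4) D^2)
    applied to [hpoly s a]. Since D acts on the [hpoly s] as on monomials, expanding this
    exponential gives the coefficients. *)
Definition connection_coef s a m : R :=
  if even_diff a m then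
    (- (1 - s) / 4) ^+ (a - m)./2 * a`!%:R / (((a - m)./2)`!%:R * m`!%:R)
  else 0.

Lemma connection_coefE s m k : connection_coef s (m + k.*2) m =
  (- (1 - s) / 4) ^+ k * (m + k.*2)`!%:R / (k`!%:R * m`!%:R).
Proof.
rewrite /connection_coef half_diff; case: even_diffP => // -[].
by exists k.
Qed.

Lemma connection_coef_refl s a : connection_coef s a a = 1.
Proof.
rewrite -{1}(addn0 a) -[0%N]double0 connection_coefE addn0 expr0 fact0 !mul1r divff//.
Qed.

Lemma connection_coef_gt s a m : (a < m)%N -> connection_coef s a m = 0.
Proof.
by move=> am; rewrite /connection_coef /even_diff leqNgt am.
Qed.

(** Reflects X - D / 2 = (X - (s / 2) D) - ((1 - s) / 2) D on the basis [hpoly s]: the first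
    operator raises the index, the second lowers it with a factor equal to the index. *)
Lemma connection_coefS s a m : connection_coef s a.+1 m =
  (if m is m'.+1 then connection_coef s a m' else 0) -
  (1 - s) / 2 * m.+1%:R * connection_coef s a m.+1.
Proof.
have fn0 k : k`!%:R != 0 :> R by rewrite pnatr_eq0 -lt0n fact_gt0.
have Sn0 k : k%:R + 1 != 0 :> R by rewrite natr1 pnatr_eq0.
have [/even_diffP [k aE]|aN] := boolP (even_diff a.+1 m); last first.
  rewrite {1}/connection_coef (negbTE aN) /connection_coef.
  case: even_diffP => [[k aE]|_].
    by case/even_diffP: aN; exists k.+1; rewrite aE doubleS !addnS addSn.
  case: m aN => [|m] aN; first by rewrite mulr0 subrr.
  case: even_diffP => [[k aE]|_]; last by rewrite mulr0 subrr.
  by case/even_diffP: aN; exists k; rewrite aE addSn.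
rewrite aE connection_coefE; case: k aE => [|k].
  rewrite addn0; case: m => // m [->].
  rewrite (@connection_coef_gt s m m.+2)// mulr0 subr0 connection_coef_refl.
  by rewrite expr0 fact0 !mul1r divff.
rewrite doubleS !addnS => -[aE].
have -> : connection_coef s a m.+1 =
    (- (1 - s) / 4) ^+ k * (m.+1 + k.*2)`!%:R / (k`!%:R * m.+1`!%:R).
  by rewrite aE -addSn connection_coefE.
have k0 : 0 <= k%:R :> R by [].
case: m aE => [|m] aE.
  rewrite sub0r !(add0n, add1n, factS, natrM, exprS) fact0.
  rewrite -[k.*2.+2%:R]natr1 -[k.*2.+1%:R]natr1 -[k.+1%:R]natr1 -muln2 natrM.
  move: ((k * 2)`!%:R) ((- (1 - s) / 4) ^+ k) => u v; field.
  by rewrite fn0 Sn0.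
have -> : connection_coef s a m = (- (1 - s) / 4) ^+ k.+1 *
    (m + k.+1.*2)`!%:R / (k.+1`!%:R * m`!%:R).
  rewrite -connection_coefE; congr (connection_coef _ _ _).
  by rewrite aE addSn doubleS !addnS.
have m0 : 0 <= m%:R :> R by [].
rewrite doubleS !addnS !(addSn, factS, natrM, exprS).
rewrite -[(m + k.*2).+3%:R]natr1 -[(m + k.*2).+2%:R]natr1.
rewrite -[(m + k.*2).+1%:R]natr1 -[k.+1%:R]natr1 -[m.+2%:R]natr1 -[m.+1%:R]natr1.
move: ((m + k.*2)`!%:R) ((- (1 - s) / 4) ^+ k) => u v.
rewrite natrD -muln2 natrM; field.
by rewrite !fn0 !Sn0 gt_eqF//; lra.
Qed.

Lemma hpoly_connection s a N : (a < N)%N ->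
  hpoly 1 a = \sum_(m < N) connection_coef s a m *: hpoly s m.
Proof.
elim: a N => [|a IH] [|N]// aN.
  rewrite big_ord_recl big1 ?addr0 => [|m _].
    by rewrite (connection_coef_refl s 0) scale1r.
  by rewrite connection_coef_gt// scale0r.
rewrite [LHS]/= (IH N.+1 (ltnW aN)) linear_sum mulr_sumr scaler_sumr/=.
pose c := connection_coef s a.
have -> : \sum_(m < N.+1) 'X * (c m *: hpoly s m) -
    \sum_(m < N.+1) (1 / 2) *: (c m *: hpoly s m)^`() =
    \sum_(m < N.+1) c m *: hpoly s m.+1 -
    \sum_(m < N.+1) ((1 - s) / 2 * c m * m%:R) *: hpoly s m.-1.
  rewrite -!sumrB; apply: eq_bigr => m _.
  rewrite derivZ /= deriv_hpoly -scalerAr scalerBr !scalerA -[RHS]addrA -opprD.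
  by rewrite -scalerDl; congr (_ - _ *: _); field.
under [RHS]eq_bigr do rewrite connection_coefS scalerBl.
rewrite sumrB; congr (_ - _).
  rewrite big_ord_recr [RHS]big_ord_recl/= [c N]connection_coef_gt// !scale0r.
  by rewrite add0r addr0.
rewrite big_ord_recl [RHS]big_ord_recr/= connection_coef_gt; last by rewrite ltnW.
rewrite !(mulr0, scale0r) add0r addr0; apply: eq_bigr => m _.
by rewrite /c /= /bump leq0n add1n /=; congr (_ *: _); ring.
Qed.

End HermitePolynomials.

Section HermiteFunctions.
Context {R : realType}.
Implicit Types (t x : R) (a b m k N : nat).
Notation mu := (@lebesgue_measure R).

Lemma derive1n_gauss m : (fun r : R => expR (- r ^+ 2))^`(m)%classic =
  poly_gauss 1 ((- 2) ^+ m *: hpoly 1 m).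
Proof.
elim: m => [|m IH].
  by apply/funext => r; rewrite derive1n0 /poly_gauss scale1r hornerC !mul1r.
apply/funext => r; rewrite derive1nS IH derive1E.
have /@derive_val -> := is_derive_poly_gauss 1 ((- 2) ^+ m *: hpoly 1 m) r.
congr (poly_gauss _ _ _); rewrite derivZ -scalerAr scalerA /= exprS.
rewrite scalerBr !scalerA [RHS]addrC.
rewrite -(scaleNr _ (hpoly 1 m)^`()) -(scaleNr _ ('X * hpoly 1 m)).
by move: ((- 2) ^+ m) => c; congr (_ *: _ + _ *: _); field.
Qed.

(** The normalization for monic polynomials: the usual Hermite polynomial has leading coefficient
    2^m. *)
Definition hermite_norm m : R := Num.sqrt (2 ^+ m / (m`!%:R * Num.sqrt pi)).

Lemma hermiteE m x :
  hermite m x = hermite_norm m * poly_gauss (1 / 2) (hpoly 1 m) x.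
Proof.
rewrite /hermite derive1n_gauss /poly_gauss hornerZ.
have -> : expR (- (1 / 2 * x ^+ 2)) = expR (x ^+ 2 / 2) * expR (- (1 * x ^+ 2)).
  by rewrite -expRD; congr expR; field.
set E1 := expR _; set E2 := expR _; set h := _.[x].
have p0 : 0 < Num.sqrt pi :> R by rewrite sqrtr_gt0 pi_gt0.
have f0 : 0 < m`!%:R :> R by rewrite ltr0n fact_gt0.
have q0 : 0 < 2 ^+ m :> R by rewrite exprn_gt0.
have -> : hermite_norm m = 2 ^+ m / Num.sqrt (2 ^+ m * m`!%:R * Num.sqrt pi).
  rewrite /hermite_norm.
  have -> : 2 ^+ m / (m`!%:R * Num.sqrt pi) =
      (2 ^+ m) ^+ 2 / (2 ^+ m * m`!%:R * Num.sqrt pi) :> R.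
    by field; rewrite !gt_eqF.
  by rewrite sqrtrM ?sqr_ge0// sqrtr_sqr ger0_norm ?(ltW q0)// sqrtrV// !mulr_ge0// ltW.
have -> : (- 2) ^+ m = (-1) ^+ m * 2 ^+ m :> R by rewrite -exprMn mulN1r.
have := sqrr_sign R m; rewrite expr2.
move: ((-1) ^+ m) => sg hs.
have n0 : Num.sqrt (2 ^+ m * m`!%:R * Num.sqrt pi) != 0 :> R.
  by rewrite gt_eqF// sqrtr_gt0 !mulr_gt0.
transitivity (sg * sg * (2 ^+ m / Num.sqrt (2 ^+ m * m`!%:R * Num.sqrt pi) * (h * (E1 * E2)))).
  by ring.
by rewrite hs mul1r.
Qed.

Lemma continuous_hermite m : continuous (@hermite R m).
Proof.
have -> : @hermite R m = (fun x => hermite_norm m * poly_gauss (1 / 2) (hpoly 1 m) x).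
  by apply/funext => x; exact: hermiteE.
move=> x; apply: cvgM; first exact: cvg_cst.
exact: continuous_poly_gauss.
Qed.

Lemma measurable_hermite m : measurable_fun setT (@hermite R m).
Proof. by apply: continuous_measurable_fun; exact: continuous_hermite. Qed.

(** The exponents add up to 1 + t, so the polynomials [hpoly s] with s = 1 / (1 + t) are the
    orthogonal ones for this integral. *)
Lemma hermite_product_gaussE t a b x :
  hermite a x * hermite b x * expR (- (t * x ^+ 2)) =
  hermite_norm a * hermite_norm b * poly_gauss (1 + t) (hpoly 1 a * hpoly 1 b) x.
Proof.
rewrite !hermiteE /poly_gauss hornerM.
have -> : - ((1 + t) * x ^+ 2) = - (1 / 2 * x ^+ 2) + - (1 / 2 * x ^+ 2) + - (t * x ^+ 2).
  by field.
by rewrite !expRD; ring.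
Qed.

Lemma integrable_hermite_product t a b : 0 <= t -> mu.-integrable setT
  (EFin \o (fun x => hermite a x * hermite b x * expR (- (t * x ^+ 2)))).
Proof.
move=> t0; have t1 : 0 < 1 + t by lra.
have := integrableZl measurableT (hermite_norm a * hermite_norm b)
  (integrable_poly_gauss (hpoly 1 a * hpoly 1 b) t1).
apply: eq_integrable => // x _ /=.
by rewrite hermite_product_gaussE.
Qed.

(** The square root is the norm of [hpoly s m] without its powers of s, which go to the factor sqrt
    s * s^m of [hermite_product_integral]. *)
Lemma mehler_coefE s a m : 0 < s :> R ->
  hermite_norm a * connection_coef s a m * Num.sqrt (m`!%:R * Num.sqrt pi / 2 ^+ m)
  = mehler_coef (1 - s) a m.
Proof.
move=> s0; rewrite /connection_coef /mehler_coef.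
case: even_diffP => [[k ->]|_]; last by rewrite mulr0 mul0r.
rewrite half_diff /hermite_norm.
set b := (m + k.*2)%N.
have p0 : 0 < Num.sqrt pi :> R by rewrite sqrtr_gt0 pi_gt0.
have f0 j : 0 < j`!%:R :> R by rewrite ltr0n fact_gt0.
have q0 j : 0 < 2 ^+ j :> R by rewrite exprn_gt0.
rewrite mulrAC -sqrtrM; last by rewrite divr_ge0// ?mulr_ge0// ltW.
have -> : 2 ^+ b / (b`!%:R * Num.sqrt pi) * (m`!%:R * Num.sqrt pi / 2 ^+ m) =
    (2 ^+ k * m`!%:R / b`!%:R) ^+ 2 * (b`!%:R / m`!%:R) :> R.
  rewrite {1}/b exprD -addnn exprD; field.
  by rewrite !gt_eqF.
have z0 : 0 <= 2 ^+ k * m`!%:R / b`!%:R :> R by rewrite divr_ge0 ?mulr_ge0// ltW.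
rewrite sqrtrM ?sqr_ge0// sqrtr_sqr ger0_norm//.
have -> : (- (1 - s) / 4) ^+ k = (- (1 - s) / 2) ^+ k / 2 ^+ k.
  by rewrite -expr_div_n; congr (_ ^+ _); field.
move: (Num.sqrt _) ((- (1 - s) / 2) ^+ k) => u v; field.
by rewrite !gt_eqF.
Qed.

Lemma hermite_product_integral t a b N : 0 <= t -> (a < N)%N -> (b < N)%N ->
  \int[mu]_x (hermite a x * hermite b x * expR (- (t * x ^+ 2))) =
  \sum_(m < N) Num.sqrt (1 + t)^-1 * (1 - t / (1 + t)) ^+ m *
    (mehler_coef (t / (1 + t)) a m * mehler_coef (t / (1 + t)) b m).
Proof.
move=> t0 aN bN; have t1 : 0 < 1 + t by lra.
under eq_Rintegral do rewrite hermite_product_gaussE.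
rewrite RintegralZl//; last exact: integrable_poly_gauss.
rewrite -/(gauss_mean _ _).
pose s := (1 + t)^-1; have s0 : 0 < s by rewrite invr_gt0.
have -> : t / (1 + t) = 1 - s by rewrite /s; field; rewrite gt_eqF.
rewrite (hpoly_connection s aN) (hpoly_connection s bN).
rewrite mulr_suml gauss_mean_sum// mulr_sumr; apply: eq_bigr => m _.
rewrite mulr_sumr gauss_mean_sum// -[1 + t]invrK -/s.
have gm2 c d (P Q : {poly R}) :
    gauss_mean s^-1 (c *: P * (d *: Q)) = c * d * gauss_mean s^-1 (P * Q).
  by rewrite -scalerAl -scalerAr scalerA gauss_meanZ ?invr_gt0.
rewrite (bigD1 m)//= big1 ?addr0; last first.
  move=> l lm; rewrite gm2.
  by rewrite gauss_mean_hpoly// eq_sym (inj_eq val_inj) (negbTE lm) !mulr0.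
rewrite gm2 gauss_mean_hpoly// eqxx.
rewrite -!mehler_coefE//.
set u := Num.sqrt (m`!%:R * _ / _).
have p0 : 0 <= Num.sqrt pi :> R by exact: sqrtr_ge0.
have uu : u * u = m`!%:R * Num.sqrt pi / 2 ^+ m.
  by rewrite -expr2 sqr_sqrtr// divr_ge0 ?mulr_ge0// exprn_ge0.
rewrite sqrtrM ?pi_ge0// [1 - (1 - s)](_ : _ = s); last by ring.
rewrite expr_div_n invrK.
transitivity (Num.sqrt s * s ^+ m * (hermite_norm a * connection_coef s a m *
   (hermite_norm b * connection_coef s b m)) * (u * u)); last by ring.
by rewrite uu; ring.
Qed.
End HermiteFunctions.

(** * Integrals on R^n *)

Section ProductIntegrals.
Context {R : realType}.
Notation mu := (@lebesgue_measure R).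

Lemma leb_integral_cons n (f : n.+1.-tuple R -> \bar R) :
  measurable_fun setT f ->
  (mu \x leb n)%E.-integrable setT (f \o @cons_pair R n) ->
  (leb n.+1).-integrable setT f /\
  (\int[leb n.+1]_x f x = \int[mu \x leb n]_p f (cons_pair p))%E.
Proof.
move=> mf fi.
have E (g : n.+1.-tuple R -> \bar R) : (\int[leb n.+1]_x g x =
    \int[pushforward (mu \x leb n) (@cons_pair R n)]_x g x)%E.
  by apply: (@eq_measure_integral _ _ _ _
    (pushforward (mu \x leb n)%E (@cons_pair R n)));
    [exact: measurable_cons_pair|].
have mc := @measurable_cons_pair R n.
split; last by rewrite E (integral_pushforward mc).
have /integrableP[_] := integrable_pushforward mc mf fi measurableT.
by move=> h; apply/integrableP; split=> //; rewrite E.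
Qed.

Definition tensor n (phi : 'I_n -> R -> R) (x : n.-tuple R) : R :=
  \prod_(l < n) phi l (tnth x l).

Lemma measurable_tensor n (phi : 'I_n -> R -> R) :
  (forall l, measurable_fun setT (phi l)) -> measurable_fun setT (tensor phi).
Proof.
move=> mphi; apply: measurable_prod => l _.
apply: measurableT_comp => //; exact: measurable_tnth.
Qed.

Lemma tensor_cons n (phi : 'I_n.+1 -> R -> R) p :
  tensor phi (cons_pair p) =
  phi ord0 p.1 * tensor (fun l => phi (lift ord0 l)) p.2.
Proof.
rewrite /tensor big_ord_recl; congr (_ * _); apply: eq_bigr => l _.
by rewrite tnthS.
Qed.

(** Fubini, one coordinate at a time. Integrability and value share one induction, because splitting
    off a coordinate requires the remaining tensor to be integrable. *)
Lemma tensor_integral n (phi : 'I_n -> R -> R) :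
  (forall l, mu.-integrable setT (EFin \o phi l)) ->
  (leb n).-integrable setT (EFin \o tensor phi) /\
  \int[leb n]_x tensor phi x = \prod_(l < n) \int[mu]_x phi l x.
Proof.
elim: n phi => [|n IH] phi iphi.
  have E : tensor phi = cst 1 by apply/funext => x; rewrite /tensor big_ord0.
  have I1 : (\int[leb 0]_x (1%:E : \bar R) = 1)%E.
    rewrite /= integral_dirac//.
    by rewrite diracT mul1e.
  rewrite big_ord0 E; split; last by rewrite /Rintegral I1.
  apply/integrableP; split; first by apply/measurable_EFinP; exact: measurable_cst.
  by under eq_integral do rewrite /= normr1; rewrite I1 ltry.
have mphi l : measurable_fun setT (phi l).
  by apply/measurable_EFinP; exact: measurable_int (iphi l).
pose psi l := phi (lift ord0 l).
have [ipsi Ipsi] := IH psi (fun l => iphi _).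
have mpsi : measurable_fun setT (tensor psi).
  by apply: measurable_tensor => l; exact: mphi.
have mten := measurable_tensor mphi.
have mE : measurable_fun setT (EFin \o tensor phi) by exact/measurable_EFinP.
pose f := (EFin \o tensor phi) \o @cons_pair R n.
have mf : measurable_fun setT f.
  by apply: measurableT_comp => //; exact: measurable_cons_pair.
have fE x y : f (x, y) = ((phi ord0 x)%:E * (tensor psi y)%:E)%E.
  by rewrite /f /= tensor_cons EFinM.
have fi : (mu \x leb n)%E.-integrable setT f.
  apply/integrable12ltyP => //.
  under eq_integral => x _.
    under eq_integral do rewrite fE abseM.
    rewrite ge0_integralZl//; last first.
      by apply: measurableT_comp => //; exact/measurable_EFinP.
    over.
  have /integrableP[_ i0] := iphi ord0; have /integrableP[_ i1] := ipsi.
  rewrite ge0_integralZr//.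
  - apply: lte_mul_pinfty => //; first exact: integral_ge0.
    by rewrite ge0_fin_numE//; exact: integral_ge0.
  - by apply: measurableT_comp => //; apply/measurable_EFinP; exact: mphi.
  - exact: integral_ge0.
have [h1 h2] := leb_integral_cons mE fi.
have {}h2 : (\int[leb n.+1]_x (tensor phi x)%:E = \int[mu \x leb n]_p f p)%E.
  exact: h2.
split=> //; rewrite big_ord_recl -Ipsi /Rintegral h2.
rewrite -(integral12_prod_meas1 fi).
have -> : fubini_F (leb n) f = (fun x => (phi ord0 x)%:E *
    (fine (\int[leb n]_y (tensor psi y)%:E))%:E)%E.
  apply/funext => x; rewrite /fubini_F.
  under eq_integral do rewrite fE.
  rewrite integralZl// fineK//; exact: integrable_fin_num ipsi.
rewrite integralZr//; last exact: iphi.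
rewrite -[X in fine (X * _)%E]fineK -?EFinM//.
by apply: integrable_fin_num => //; exact: iphi.
Qed.

End ProductIntegrals.

(** * Gram matrices of the Hermite functions for Gaussian weights *)

Section Gram.
Context {R : realType} (n : nat) (S : pred 'I_n).
Implicit Types (t : R) (a b : n.-tuple nat).
Notation mu := (@lebesgue_measure R).

Definition sqr_dist (x : n.-tuple R) : R := \sum_(l < n | S l) tnth x l ^+ 2.

Definition gauss_weight t (x : n.-tuple R) : R := expR (- (t * sqr_dist x)).

Let ts t l := if S l then t else 0.

Lemma gauss_weightE t : gauss_weight t = tensor (fun l s => expR (- (ts t l * s ^+ 2))).
Proof.
apply/funext => x; rewrite /gauss_weight /tensor -expR_sum; congr expR.
rewrite sumrN mulr_sumr big_mkcond/=; congr (- _); apply: eq_bigr => l _.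
by rewrite /ts; case: ifP => _; rewrite ?mul0r.
Qed.

Lemma measurable_sqr_dist : measurable_fun setT sqr_dist.
Proof.
rewrite /sqr_dist; under eq_fun do rewrite big_mkcond.
apply: measurable_sum => l; case: (S l); last exact: measurable_cst.
apply: measurable_funX; exact: measurable_tnth.
Qed.

Lemma measurable_gauss_weight t : measurable_fun setT (gauss_weight t).
Proof.
apply: measurableT_comp => //; apply: measurableT_comp => //.
by apply: measurable_funM => //; exact: measurable_sqr_dist.
Qed.

Lemma gauss_weight_ge0 t x : 0 <= gauss_weight t x.
Proof. exact: expR_ge0. Qed.

Lemma sqr_dist_ge0 x : 0 <= sqr_dist x.
Proof. by apply: sumr_ge0 => l _; exact: sqr_ge0. Qed.

Lemma gauss_weight_le1 t x : 0 <= t -> gauss_weight t x <= 1.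
Proof.
by move=> t0; rewrite /gauss_weight expR_le1 oppr_le0 mulr_ge0// sqr_dist_ge0.
Qed.

Lemma measurable_Phi a : measurable_fun setT (@Phi R n a).
Proof.
exact: (measurable_tensor (fun l => measurable_hermite (tnth a l))).
Qed.

Definition gram t a b : R :=
  \int[leb n]_x (Phi a x * Phi b x * gauss_weight t x).

Let gram_tensor t a b :
  (fun x => Phi a x * Phi b x * gauss_weight t x) =
  tensor (fun l s => hermite (tnth a l) s * hermite (tnth b l) s *
                     expR (- (ts t l * s ^+ 2))).
Proof.
by apply/funext => x; rewrite gauss_weightE /tensor /Phi !big_split/=.
Qed.

Let ts_ge0 t l : 0 <= t -> 0 <= ts t l.
Proof. by rewrite /ts; case: ifP. Qed.

Lemma integrable_gram t a b : 0 <= t -> (leb n).-integrable setT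
  (EFin \o (fun x => Phi a x * Phi b x * gauss_weight t x)).
Proof.
move=> t0; rewrite gram_tensor; apply: (tensor_integral _).1 => l.
by apply: integrable_hermite_product; exact: ts_ge0.
Qed.

Variable N : nat.
Notation index := {ffun 'I_n -> 'I_N}.

Definition multi_index (a : index) : n.-tuple nat := [tuple (a l : nat) | l < n].

Lemma multi_index_inj : injective multi_index.
Proof.
move=> a b /(congr1 (fun u => tnth u)) ab; apply/ffunP => l; apply/val_inj.
by have := congr1 (fun u => u l) ab; rewrite !tnth_mktuple.
Qed.

Lemma mlen_multi_index (a : index) : mlen (multi_index a) = level a.
Proof. by apply: eq_bigr => l _; rewrite tnth_mktuple. Qed.

Lemma gramE t (a b : index) : 0 <= t ->
  gram t (multi_index a) (multi_index b) =
  \prod_l (\sum_(m < N) Num.sqrt (1 + ts t l)^-1 *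
     (1 - (if S l then t / (1 + t) else 0)) ^+ m *
    (mehler_coef (if S l then t / (1 + t) else 0) (a l) m *
     mehler_coef (if S l then t / (1 + t) else 0) (b l) m)).
Proof.
move=> t0; rewrite /gram gram_tensor (tensor_integral _).2; last first.
  by move=> l; apply: integrable_hermite_product; exact: ts_ge0.
apply: eq_bigr => l _; rewrite !tnth_mktuple.
rewrite (@hermite_product_integral _ _ _ _ N) ?ts_ge0//.
have -> // : ts t l / (1 + ts t l) = if S l then t / (1 + t) else 0.
by rewrite /ts; case: ifP => _; rewrite ?mul0r.
Qed.

(** Orthonormality of the Hermite functions, as the unweighted case of [gramE]. *)
Lemma gram0 (a b : index) :
  gram 0 (multi_index a) (multi_index b) = (a == b)%:R.
Proof.
rewrite gramE// mul0r.
have E l : (\sum_(m < N) Num.sqrt (1 + ts 0 l)^-1 * (1 - (if S l then 0 else 0)) ^+ m *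
    (mehler_coef (if S l then 0 else 0) (a l) m *
     mehler_coef (if S l then 0 else 0) (b l) m)) = (a l == b l)%:R :> R.
  rewrite /ts if_same addr0 invr1 sqrtr1 subr0.
  under eq_bigr do rewrite expr1n !mul1r !mehler_coef0.
  rewrite (bigD1 (a l))//= eqxx mul1r big1 ?addr0 1?eq_sym// => m.
  by rewrite eq_sym -(inj_eq val_inj) => /negbTE ->; rewrite mul0r.
under eq_bigr do rewrite E.
have [->|ab] := eqVneq a b; first by rewrite big1// => l _; rewrite eqxx.
have /existsP[l /negbTE al] : [exists l, a l != b l].
  apply: contraNT ab => /existsPn h; apply/eqP/ffunP => l; apply/eqP.
  by have := h l; rewrite negbK.
by rewrite (bigD1 l)//= al mul0r.
Qed.

Lemma gram_level_le t (p : index -> R) : 0 <= t -> #|S| = 3%N ->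
  \sum_a \sum_(b | level b == level a)
     p a * p b * gram t (multi_index a) (multi_index b) <=
  \sum_a p a ^+ 2 * (Num.sqrt (1 + t)^-1 ^+ 3 *
     level_weight S (t / (1 + t)) (levelin S a)).
Proof.
move=> t0 S3; under eq_bigr do under eq_bigr do rewrite gramE//.
have e01 : 0 <= t / (1 + t) <= 1.
  by rewrite divr_ge0 ?addr_ge0//= ler_pdivrMr ?mul1r ?lerDr// ltr_pwDl.
have := key_inequality S e01 p (fun l => sqrtr_ge0 (1 + ts t l)^-1).
move=> /le_trans; apply; rewrite le_eqVlt; apply/orP; left; apply/eqP.
apply: eq_bigr => a _; congr (_ * (_ * _)).
rewrite (bigID S)/= [X in _ * X]big1 ?mulr1 => [|l Sl]; last first.
  by rewrite /ts (negbTE Sl) addr0 invr1 sqrtr1.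
under eq_bigr => l Sl do rewrite /ts Sl.
by rewrite prodr_const S3.
Qed.

End Gram.

Section TimeAverage.
Context {R : realType}.
Notation mu := (@lebesgue_measure R).

Lemma sin_cos_mul2pi k : sin (k%:R * (2 * pi)) = 0 :> R /\ cos (k%:R * (2 * pi)) = 1 :> R.
Proof.
elim: k => [|k [IHs IHc]]; first by rewrite mul0r sin0 cos0.
have -> : k.+1%:R * (2 * pi) = k%:R * (2 * pi) + pi *+ 2 :> R.
  by rewrite -natr1 -mulr_natl; ring.
by rewrite sinD2pi cosD2pi.
Qed.

(** For j different from k, the antiderivative takes the same value at 0 and 2 pi because the
    frequency is an integer. *)
Lemma integral_trig (j k : nat) (A B : R) :
  (\int[mu]_(t in `[0%R, (2 * pi)%R])
     (A * cos ((j%:R - k%:R) * t) + B * sin ((j%:R - k%:R) * t))%:E =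
   (if j == k then 2 * pi * A else 0)%:E)%E.
Proof.
have pi2 : 0 < 2 * pi :> R by rewrite mulr_gt0// pi_gt0.
case: eqVneq => [->|jk].
  under eq_integral do rewrite subrr mul0r cos0 sin0 mulr1 mulr0 addr0.
  rewrite integral_cst//= lebesgue_measure_itv/= lte_fin pi2 -EFinB -EFinM.
  by rewrite subr0 mulrC.
set c : R := j%:R - k%:R; have c0 : c != 0 by rewrite subr_eq0 eqr_nat.
pose F (t : R) : R := A / c * sin (c * t) - B / c * cos (c * t).
have dF (t : R) : is_derive t 1 F (A * cos (c * t) + B * sin (c * t)).
  rewrite /F; apply: is_derive_eq; rewrite /GRing.scale/=.
  by field.
have cF : continuous F.
  by move=> t; apply: differentiable_continuous; exact/derivable1_diffP/ex_derive.
have cf : continuous (fun t : R => A * cos (c * t) + B * sin (c * t)).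
  have cc : continuous (fun t : R => c * t) by exact: mulrl_continuous.
  move=> t; apply: cvgD; apply: cvgM; do ?exact: cvg_cst.
    by apply: (continuous_comp (cc t)); exact: continuous_cos.
  by apply: (continuous_comp (cc t)); exact: continuous_sin.
rewrite (@continuous_FTC2 _ _ F)//.
- have cE : c * (2 * pi) = j%:R * (2 * pi) - k%:R * (2 * pi) by rewrite /c mulrBl.
  rewrite /F cE cosB sinB mulr0 cos0 sin0.
  have [-> ->] := sin_cos_mul2pi j; have [-> ->] := sin_cos_mul2pi k.
  by rewrite -EFinB; congr EFin; ring.
- exact: continuous_subspaceT.
- split => [x _||].
  + exact: ex_derive.
  + exact/cvg_at_right_filter/cF.
  + exact/cvg_at_left_filter/cF.
- by move=> x _; rewrite derive1E derive_val.
Qed.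

End TimeAverage.

(** * Weighted norms of the partial Hermite sums *)

Section HermiteSums.
Local Open Scope complex_scope.
Context {R : realType} (n : nat).
Notation mu := (@lebesgue_measure R).

Lemma normc_sqr (z : R[i]) : normc z ^+ 2 = complex.Re z ^+ 2 + complex.Im z ^+ 2.
Proof. by case: z => a b /=; rewrite sqr_sqrtr// addr_ge0 ?sqr_ge0. Qed.

Section Cube.
Variable N : nat.
Notation index := {ffun 'I_n -> 'I_N}.

(** Cubes are cofinal among the finite sets of multi-indices ([sub_cube]), so a limit along
    [totally] may be tested on them, and there all forms are finite matrices. *)
Definition cube : {fset n.-tuple nat} :=
  [fset multi_index a | a in {: index}]%fset.

Lemma sum_cube (V : nmodType) (F : n.-tuple nat -> V) :
  \sum_(a <- cube) F a = \sum_(a : index) F (multi_index a).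
Proof.
by rewrite /cube big_imfset/= => [|a b _ _]; [rewrite big_enum|exact: multi_index_inj].
Qed.

Variable f : n.-tuple R -> R[i].

Definition coef_re (a : index) : R := complex.Re (hermite_coef f (multi_index a)).
Definition coef_im (a : index) : R := complex.Im (hermite_coef f (multi_index a)).

Definition phase (a : index) (t : R) : R := (2 * level a + n)%N%:R * t.

Definition wave_re (a : index) (t : R) : R :=
  cos (phase a t) * coef_re a + sin (phase a t) * coef_im a.
Definition wave_im (a : index) (t : R) : R :=
  cos (phase a t) * coef_im a - sin (phase a t) * coef_re a.

Lemma hermite_sum_cubeE t x : hermite_sum f cube t x =
  (\sum_a wave_re a t * Phi (multi_index a) x) +i*
  (\sum_a wave_im a t * Phi (multi_index a) x).
Proof.
have sumC (F G : index -> R) :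
    (\sum_a F a) +i* (\sum_a G a) = \sum_a (F a +i* G a) :> R[i].
  apply: (big_rec3 (fun u v w => u +i* v = w)) => //= a u v w _ <-.
  by [].
rewrite /hermite_sum sum_cube sumC; apply: eq_bigr => a _.
rewrite mlen_multi_index /expNi -/(phase a t) /wave_re /wave_im /coef_re /coef_im.
case: (hermite_coef f _) => p q /=.
apply/eqP; rewrite eq_complex /=; apply/andP; split; apply/eqP; ring.
Qed.

(** The real part of the a-th wave times the conjugate of the b-th. The shift n of the eigenvalues
    cancels. *)
Lemma wave_product (a b : index) t :
  wave_re a t * wave_re b t + wave_im a t * wave_im b t =
  (coef_re a * coef_re b + coef_im a * coef_im b) *
    cos (((2 * level a)%N%:R - (2 * level b)%N%:R) * t) +
  (coef_im a * coef_re b - coef_re a * coef_im b) *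
    sin (((2 * level a)%N%:R - (2 * level b)%N%:R) * t).
Proof.
have -> : ((2 * level a)%N%:R - (2 * level b)%N%:R) * t = phase a t - phase b t.
  by rewrite /phase !natrD; ring.
rewrite cosB sinB /wave_re /wave_im; ring.
Qed.

Variables (S : pred 'I_n).

Lemma integral_sum_Phi_sqr (u : index -> R) (s : R) : 0 <= s ->
  (\int[leb n]_x (((\sum_a u a * Phi (multi_index a) x) ^+ 2 *
      gauss_weight S s x)%:E) =
  (\sum_a \sum_b u a * u b * gram S s (multi_index a) (multi_index b))%:E)%E.
Proof.
move=> s0.
pose g (ab : index * index) (x : n.-tuple R) := ((u ab.1 * u ab.2)%:E *
  (Phi (multi_index ab.1) x * Phi (multi_index ab.2) x * gauss_weight S s x)%:E)%E.
have ig ab : (leb n).-integrable setT (g ab).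
  by apply: integrableZl => //; exact: integrable_gram.
transitivity (\int[leb n]_x \sum_ab g ab x)%E.
  apply: eq_integral => x _; rewrite sumEFin; congr EFin.
  rewrite -(pair_bigA _ (fun a b => u a * u b *
    (Phi (multi_index a) x * Phi (multi_index b) x * gauss_weight S s x)))/=.
  rewrite expr2 mulr_suml mulr_suml; apply: eq_bigr => a _.
  by rewrite mulr_sumr mulr_suml; apply: eq_bigr => b _; ring.
rewrite integral_sum// pair_bigA/= -sumEFin; apply: eq_bigr => ab _.
rewrite integralZl//; last exact: integrable_gram.
rewrite [RHS]EFinM /gram /Rintegral fineK//.
by apply: integrable_fin_num => //; exact: integrable_gram.
Qed.

Definition cube_energy (s t : R) : R := \sum_a \sum_b
  (wave_re a t * wave_re b t + wave_im a t * wave_im b t) *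
  gram S s (multi_index a) (multi_index b).

Lemma measurable_sum_Phi (u : index -> R) :
  measurable_fun setT (fun x => \sum_a u a * Phi (multi_index a) x).
Proof.
by apply: measurable_sum => a; apply: measurable_funM => //; exact: measurable_Phi.
Qed.

Lemma integral_hermite_sum s t : 0 <= s ->
  (\int[leb n]_x ((normc (hermite_sum f cube t x) ^+ 2 * gauss_weight S s x)%:E) =
   (cube_energy s t)%:E)%E.
Proof.
move=> s0.
under eq_integral do rewrite hermite_sum_cubeE normc_sqr/= mulrDl EFinD.
rewrite ge0_integralD//; last 4 first.
- by move=> x _; rewrite lee_fin mulr_ge0 ?sqr_ge0// gauss_weight_ge0.
- apply/measurable_EFinP; apply: measurable_funM; last exact: measurable_gauss_weight.
  by apply: measurable_funX; exact: measurable_sum_Phi.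
- by move=> x _; rewrite lee_fin mulr_ge0 ?sqr_ge0// gauss_weight_ge0.
- apply/measurable_EFinP; apply: measurable_funM; last exact: measurable_gauss_weight.
  by apply: measurable_funX; exact: measurable_sum_Phi.
rewrite !integral_sum_Phi_sqr// -EFinD; congr EFin.
rewrite /cube_energy -big_split; apply: eq_bigr => a _ /=.
by rewrite -big_split; apply: eq_bigr => b _ /=; rewrite -mulrDl.
Qed.

Lemma continuous_wave_product (a b : index) :
  continuous (fun t => wave_re a t * wave_re b t + wave_im a t * wave_im b t).
Proof.
under eq_fun do rewrite wave_product.
set c : R := _ - _.
have cc : continuous (fun t : R => c * t) by exact: mulrl_continuous.
move=> t; apply: cvgD; apply: cvgM; do ?exact: cvg_cst.
  by apply: (continuous_comp (cc t)); exact: continuous_cos.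
by apply: (continuous_comp (cc t)); exact: continuous_sin.
Qed.

Lemma measurable_cube_energy s D : measurable_fun D (cube_energy s).
Proof.
apply: measurable_funTS; apply: measurable_sum => a; apply: measurable_sum => b.
apply: measurable_funM => //; apply: continuous_measurable_fun.
exact: continuous_wave_product.
Qed.

Lemma cube_energy_ge0 s t : 0 <= s -> 0 <= cube_energy s t.
Proof.
move=> s0; rewrite -lee_fin -integral_hermite_sum//; apply: integral_ge0 => x _.
by rewrite lee_fin mulr_ge0 ?sqr_ge0// gauss_weight_ge0.
Qed.

Lemma integral_cube_energy s :
  (\int[mu]_(t in `[0%R, (2 * pi)%R]) (cube_energy s t)%:E =
   (2 * pi * \sum_a \sum_(b | level b == level a)
     (coef_re a * coef_re b + coef_im a * coef_im b) *
     gram S s (multi_index a) (multi_index b))%:E)%E.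
Proof.
pose g (ab : index * index) t :=
  ((gram S s (multi_index ab.1) (multi_index ab.2))%:E *
  (wave_re ab.1 t * wave_re ab.2 t + wave_im ab.1 t * wave_im ab.2 t)%:E)%E.
have iw (ab : index * index) : mu.-integrable `[0%R, (2 * pi)%R]
    (fun t => (wave_re ab.1 t * wave_re ab.2 t + wave_im ab.1 t * wave_im ab.2 t)%:E).
  apply: continuous_compact_integrable; first exact: segment_compact.
  by apply: continuous_subspaceT; exact: continuous_wave_product.
have ig ab : mu.-integrable `[0%R, (2 * pi)%R] (g ab).
  by apply: integrableZl => //; exact: iw.
transitivity (\int[mu]_(t in `[0%R, (2 * pi)%R]) \sum_ab g ab t)%E.
  apply: eq_integral => t _; rewrite sumEFin; congr EFin.
  rewrite -(pair_bigA _ (fun a b => gram S s (multi_index a) (multi_index b) *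
    (wave_re a t * wave_re b t + wave_im a t * wave_im b t)))/=.
  by apply: eq_bigr => a _; apply: eq_bigr => b _; rewrite mulrC.
rewrite integral_sum// mulr_sumr.
under [in RHS]eq_bigr do rewrite mulr_sumr big_mkcond/=.
rewrite pair_bigA/= -sumEFin; apply: eq_bigr => -[a b] _ /=.
rewrite integralZl//.
rewrite /=; under eq_integral do rewrite wave_product.
rewrite integral_trig eqn_mul2l/= eq_sym; case: eqP => _; last by rewrite mule0.
by rewrite -EFinM; congr EFin; ring.
Qed.

(** After the time average only the cosine part at equal levels is left: the same real form,
    evaluated at the real and at the imaginary parts of the coefficients. *)
Lemma integral_cube_energy_le s : 0 <= s -> #|S| = 3%N ->
  (\int[mu]_(t in `[0%R, (2 * pi)%R]) (cube_energy s t)%:E <=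
   (2 * pi * \sum_a (coef_re a ^+ 2 + coef_im a ^+ 2) *
     (Num.sqrt (1 + s)^-1 ^+ 3 * level_weight S (s / (1 + s)) (levelin S a)))%:E)%E.
Proof.
move=> s0 S3; rewrite integral_cube_energy lee_fin ler_wpM2l ?mulr_ge0 ?pi_ge0//.
under [leRHS]eq_bigr do rewrite mulrDl.
under [leLHS]eq_bigr do (under eq_bigr do rewrite mulrDl; rewrite big_split/=).
by rewrite !big_split/= lerD// gram_level_le.
Qed.

End Cube.
End HermiteSums.

(** * Square-integrable functions *)

Section L2.
Context {R : realType} (n : nat).

Lemma L2norm_ge0 (f : n.-tuple R -> R[i]) : (0 <= L2norm f)%E.
Proof. exact: Lnorm_ge0. Qed.

Lemma L2norm_sqr (f : n.-tuple R -> R[i]) :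
  (L2norm f ^+ 2 = \int[leb n]_x (normc (f x) ^+ 2)%:E)%E.
Proof.
have -> : (L2norm f ^+ 2 = L2norm f `^ 2)%E.
  move: (L2norm f) (L2norm_ge0 f) => [r r0||//].
    by rewrite poweR_EFin powR_mulrn.
  by rewrite poweRyr.
rewrite /L2norm poweR_Lnorm//; apply: eq_integral => x _ /=.
have z0 : 0 <= normc (f x) by case: (f x) => a b /=; exact: sqrtr_ge0.
by rewrite ger0_norm// powR_mulrn.
Qed.

Lemma measurable_normc_sqr (f : n.-tuple R -> R[i]) :
  measurable_fun setT (@complex.Re R \o f) ->
  measurable_fun setT (@complex.Im R \o f) ->
  measurable_fun setT (fun x => normc (f x) ^+ 2).
Proof.
move=> mr mi; under eq_fun do rewrite normc_sqr.
by apply: measurable_funD; apply: measurable_funX.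
Qed.

Section Bessel.
Variable N : nat.
Notation index := {ffun 'I_n -> 'I_N}.

(** Expands the nonnegative integral of (g - s)^2, with s the projection of g onto the span of the
    cube. *)
Lemma bessel_real (g : n.-tuple R -> R) : measurable_fun setT g ->
  (leb n).-integrable setT (fun x => (g x ^+ 2)%:E) ->
  \sum_(a : index) (\int[leb n]_x (g x * Phi (multi_index a) x)) ^+ 2 <=
  \int[leb n]_x (g x ^+ 2).
Proof.
move=> mg ig2; set c := fun a : index => \int[leb n]_x (g x * Phi (multi_index a) x).
rewrite -/(c _).
(* A trivial weight, through which [integral_sum_Phi_sqr] and [gram0] yield the norm of s. *)
have wE (x : n.-tuple R) : gauss_weight (pred0 : pred 'I_n) 0 x = 1.
  by rewrite /gauss_weight mul0r oppr0 expR0.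
have iPP (a b : index) : (leb n).-integrable setT
    (EFin \o (fun x : n.-tuple R => Phi (multi_index a) x * Phi (multi_index b) x)).
  have := integrable_gram (pred0 : pred 'I_n) (multi_index a) (multi_index b) (lexx (0 : R)).
  by apply: eq_integrable => // x _; rewrite /= wE mulr1.
have igP (a : index) : (leb n).-integrable setT
    (EFin \o (fun x => g x * Phi (multi_index a) x)).
  apply: (le_integrable _ _ _ (integrableD measurableT ig2 (iPP a a))) => //.
    apply/measurable_EFinP; apply: measurable_funM => //; exact: measurable_Phi.
  move=> x _ /=; rewrite lee_fin; move: (g x) (Phi _ x) => u v.
  rewrite [leRHS]ger0_norm; last nra.
  by rewrite ler_norml; apply/andP; split; nra.
pose s x := \sum_(a : index) c a * Phi (multi_index a) x.
have s2E : (\int[leb n]_x (s x ^+ 2)%:E = (\sum_a c a ^+ 2)%:E)%E.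
  have := integral_sum_Phi_sqr (pred0 : pred 'I_n) c (lexx (0 : R)).
  under eq_integral do rewrite wE mulr1.
  move=> ->; congr EFin; apply: eq_bigr => a _.
  rewrite (bigD1 a)//= big1 => [|b ba]; rewrite gram0.
    by rewrite eqxx mulr1 addr0 expr2.
  by rewrite eq_sym (negbTE ba) mulr0.
have is2 : (leb n).-integrable setT (fun x => (s x ^+ 2)%:E).
  apply/integrableP; split.
    by apply/measurable_EFinP; apply: measurable_funX; exact: measurable_sum_Phi.
  under eq_integral do rewrite gee0_abs ?lee_fin ?sqr_ge0//.
  by rewrite s2E ltry.
have igs : (leb n).-integrable setT (EFin \o (fun x => g x * s x)).
  have := @integrable_sum _ _ _ (leb n) setT measurableT _ (index_enum index)
    xpredT _ (fun a _ => integrableZl measurableT (c a) (igP a)).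
  apply: eq_integrable => // x _ /=.
  rewrite /s mulr_sumr sumEFin; congr EFin; apply: eq_bigr => a _; ring.
have gsE : \int[leb n]_x (g x * s x) = \sum_a c a ^+ 2.
  rewrite /Rintegral.
  transitivity (fine (\int[leb n]_x \sum_a ((c a)%:E * (g x * Phi (multi_index a) x)%:E))%E).
    congr fine; apply: eq_integral => x _.
    rewrite /s mulr_sumr sumEFin; congr EFin; apply: eq_bigr => a _; ring.
  rewrite integral_sum//; last by move=> a; apply: integrableZl => //; exact: igP.
  rewrite -[RHS]/(fine (_%:E)) -sumEFin; congr fine; apply: eq_bigr => a _.
  rewrite integralZl//; last exact: igP.
  rewrite expr2 EFinM /c /Rintegral fineK//.
  by apply: integrable_fin_num => //; exact: igP.
have : 0 <= \int[leb n]_x ((g x - s x) ^+ 2).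
  by apply: Rintegral_ge0 => x _; exact: sqr_ge0.
have i2gs : (leb n).-integrable setT (EFin \o (fun x => 2 * (g x * s x))).
  by have := integrableZl measurableT 2 igs; apply: eq_integrable.
have -> : \int[leb n]_x ((g x - s x) ^+ 2) =
    \int[leb n]_x (g x ^+ 2 - 2 * (g x * s x) + s x ^+ 2).
  by apply: eq_Rintegral => x _; ring.
rewrite RintegralD//; last first.
  by have := integrableB measurableT ig2 i2gs; apply: eq_integrable.
rewrite RintegralB// RintegralZl// gsE [X in _ + X]/Rintegral s2E /=.
lra.
Qed.

Lemma bessel (f : n.-tuple R -> R[i]) : in_L2 f ->
  ((\sum_(a : index) (coef_re f a ^+ 2 + coef_im f a ^+ 2))%:E <= L2norm f ^+ 2)%E.
Proof.
move=> [mr mi f2]; rewrite L2norm_sqr.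
have fin : (\int[leb n]_x (normc (f x) ^+ 2)%:E < +oo)%E.
  rewrite -L2norm_sqr; move: (L2norm_ge0 f) f2; case: (L2norm f) => // r _ _.
  by rewrite -EFin_expe ltry.
have int2 (h : R[i] -> R) : measurable_fun setT (h \o f) ->
    (forall z, h z ^+ 2 <= normc z ^+ 2) ->
    (leb n).-integrable setT (fun x => ((h \o f) x ^+ 2)%:E).
  move=> mh hle; apply/integrableP; split.
    by apply/measurable_EFinP; apply: measurable_funX.
  apply: le_lt_trans fin; apply: ge0_le_integral => //.
  - by apply: measurableT_comp => //; apply/measurable_EFinP; apply: measurable_funX.
  - by apply/measurable_EFinP; exact: measurable_normc_sqr.
  - by move=> x _; rewrite gee0_abs ?lee_fin ?sqr_ge0//; exact: hle.
have ir := int2 _ mr (fun z => _); have ii := int2 _ mi (fun z => _).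
have {}ir : (leb n).-integrable setT (fun x => ((@complex.Re R \o f) x ^+ 2)%:E).
  by apply: ir => z; rewrite normc_sqr lerDl sqr_ge0.
have {}ii : (leb n).-integrable setT (fun x => ((@complex.Im R \o f) x ^+ 2)%:E).
  by apply: ii => z; rewrite normc_sqr lerDr sqr_ge0.
rewrite big_split/= EFinD.
have -> : (\int[leb n]_x (normc (f x) ^+ 2)%:E =
   (\int[leb n]_x ((@complex.Re R \o f) x ^+ 2))%:E +
   (\int[leb n]_x ((@complex.Im R \o f) x ^+ 2))%:E)%E.
  under eq_integral do rewrite normc_sqr EFinD.
  rewrite integralD//= /Rintegral !fineK//; exact: integrable_fin_num.
by apply: leeD; rewrite lee_fin; exact: bessel_real.
Qed.

End Bessel.
End L2.

(** * Passage to the limit *)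

(* Spares a proof that the integral in x of the solution is measurable in t. *)
Lemma ge0_le_integral_nonmeasurable d (T : measurableType d) (R : realType)
    (mu : {measure set T -> \bar R}) (D : set T) (f g : T -> \bar R) :
  (forall x, D x -> (0 <= f x)%E) -> (forall x, D x -> (f x <= g x)%E) ->
  (\int[mu]_(x in D) f x <= \int[mu]_(x in D) g x)%E.
Proof.
move=> f0 fg; have g0 x : D x -> (0 <= g x)%E.
  by move=> Dx; exact: le_trans (f0 _ Dx) (fg _ Dx).
rewrite !ge0_integralE//; apply: ereal_sup_le => _ [h/= hf <-].
exists h => //= x; apply: le_trans (hf x) _.
by rewrite !patchE; case: ifPn => // /set_mem; exact: fg.
Qed.

Section EventualBounds.
Context {R : realType}.
Implicit Types (c : \bar R) (u : (\bar R)^nat).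

Lemma le_limn_einf c u : (\forall N \near \oo, (c <= u N)%E) -> (c <= limn_einf u)%E.
Proof.
move=> [N _ h]; rewrite limn_einf_lim; apply: lime_ge; first exact: is_cvg_einfs.
exists N => // m /= Nm; apply: le_ereal_inf_tmp => _ [k /= mk <-].
by apply: h => /=; exact: leq_trans mk.
Qed.

Lemma limn_einf_le c u : (forall N, (u N <= c)%E) -> (limn_einf u <= c)%E.
Proof.
move=> h; rewrite limn_einf_lim; apply: lime_le; first exact: is_cvg_einfs.
apply: nearW => m; apply: le_trans (h m).
by apply: ereal_inf_lbound; exists m => /=.
Qed.
End EventualBounds.

(** The difference of the two sides is |z - 2 w|^2. *)
Lemma normc_sqr_le {R : realType} (z w : R[i]) :
  normc z ^+ 2 <= 2 * normc w ^+ 2 + 2 * normc (z - w) ^+ 2.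
Proof.
rewrite !normc_sqr; case: z w => a b [c d] /=.
have := sqr_ge0 (a - 2 * c); have := sqr_ge0 (b - 2 * d); lra.
Qed.

Lemma sub_cube n (A : {fset n.-tuple nat}) :
  \forall N \near \oo, (A `<=` cube n N)%fset.
Proof.
exists (\max_(a <- A) \max_(l < n) tnth a l).+1 => // N /= hN.
apply/fsubsetP => a aA.
have aN l : (tnth a l < N)%N.
  apply: leq_ltn_trans hN; apply: (@leq_trans (\max_(l < n) tnth a l)).
    exact: leq_bigmax.
  by rewrite (big_rem a)//= leq_maxl.
apply/imfsetP; exists [ffun l => Ordinal (aN l)] => //.
by apply: eq_from_tnth => l; rewrite tnth_mktuple ffunE.
Qed.

(** * The estimate for the singular weight *)

Section Smoothing.
Context {R : realType} (n : nat) (S : pred 'I_n).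
Hypothesis S3 : #|S| = 3%N.
Notation mu := (@lebesgue_measure R).

(* Equal to +oo where [sqr_dist S x = 0], so that it dominates 1 / |x|^2 there too
   and absorbs the junk values of a division by 0. *)
Definition singular_weight (x : n.-tuple R) : \bar R :=
  (\sum_(k <oo) (gauss_weight S k%:R x)%:E)%E.

(** If rho = 0 the series diverges; if r <= 1 its term k = 0 suffices; otherwise its sum 1 / (1 -
    exp (- rho)) is at least 1 / rho. The disjunction suits rho^(-delta), handled by one side or the
    other according to whether rho >= 1. *)
Lemma le_singular_weight x (r : R) : 0 <= r -> r <= 1 \/ r * sqr_dist S x <= 1 ->
  (r%:E <= singular_weight x)%E.
Proof.
move=> r0; have partial K : ((\sum_(k < K) gauss_weight S k%:R x)%:E <= singular_weight x)%E.
  rewrite -sumEFin -(big_mkord xpredT (fun k => (gauss_weight S k%:R x)%:E)).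
  by apply: nneseries_lim_ge => k _ _; rewrite lee_fin gauss_weight_ge0.
have [rho0 _|rho0] := eqVneq (sqr_dist S x) 0.
  apply: le_trans (partial (Num.truncn r).+1); rewrite lee_fin.
  rewrite (eq_bigr (fun=> 1)) => [|k _]; last first.
    by rewrite /gauss_weight rho0 mulr0 oppr0 expR0.
  by rewrite sumr_const card_ord; apply: ltW; exact: truncnS_gt.
have {}rho0 : 0 < sqr_dist S x by rewrite lt_def rho0 sqr_dist_ge0.
case => [r1|rr].
  apply: le_trans (partial 1%N); rewrite lee_fin big_ord1.
  by rewrite /gauss_weight mul0r oppr0 expR0.
set rho := sqr_dist S x in rho0 rr *.
apply/lee_addgt0Pr => e e0.
pose q := expR (- rho).
(* Makes exp (K rho) >= K rho >= 1 / (rho e), so the remainder q^K of the geometric sum is at most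
   rho e. *)
pose K := (Num.truncn (1 / (rho * (rho * e)))).+1.
have hq : q ^+ K <= rho * e.
  rewrite /q -expRM_natl mulrN expRN.
  have h1 : 1 / (rho * (rho * e)) < K%:R by exact: truncnS_gt.
  have h2 : 1 / (rho * e) <= expR (K%:R * rho).
    apply: le_trans (expR_ge1Dx _); apply: (@le_trans _ _ (K%:R * rho)); last by rewrite lerDr.
    rewrite -ler_pdivrMr// (le_trans _ (ltW h1))// !div1r -invfM mulrC.
    by rewrite lexx.
  rewrite -[leRHS]invrK lef_pV2 ?posrE ?expR_gt0 ?invr_gt0 ?mulr_gt0//.
  by rewrite -div1r.
have : (((r - e)%:E <= singular_weight x))%E.
  apply: le_trans (partial K); rewrite lee_fin.
  have -> : \sum_(k < K) gauss_weight S k%:R x = \sum_(k < K) q ^+ k.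
    by apply: eq_bigr => k _; rewrite /gauss_weight /q -expRM_natl mulrN.
  have q1 : 1 - q <= rho.
    by rewrite lerBlDr -lerBlDl; apply: le_trans (expR_ge1Dx _).
  have s0 : 0 <= \sum_(k < K) q ^+ k by apply: sumr_ge0 => k _; rewrite exprn_ge0// expR_ge0.
  have gs : (1 - q) * \sum_(k < K) q ^+ k = 1 - q ^+ K.
    rewrite -[1 in RHS](expr1n _ K) subrXX; congr (_ * _).
    by apply: eq_bigr => k _; rewrite expr1n mul1r.
  have := ler_wpM2r s0 q1; rewrite gs => h.
  rewrite -(@ler_pM2l _ rho)//; nra.
by rewrite EFinB leeBlDr.
Qed.

Lemma singular_weight_ge0 x : (0 <= singular_weight x)%E.
Proof. by apply: le_singular_weight => //; left. Qed.


Section Solution.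
Variables (f : n.-tuple R -> R[i]) (u : n.-tuple R -> R -> R[i]).
Hypothesis f2 : in_L2 f.
Hypothesis uf : schrodinger_solution f u.

Let mu2 t : measurable_fun setT (fun x => normc (u x t) ^+ 2).
Proof. by have [[? ? _] _] := uf t; exact: measurable_normc_sqr. Qed.

Let mdiff N t : measurable_fun setT
  (fun x => normc (u x t - hermite_sum f (cube n N) t x) ^+ 2).
Proof.
have [[mr mi _] _] := uf t; apply: measurable_normc_sqr.
- apply: (eq_measurable_fun (fun x => (@complex.Re R \o (u ^~ t)) x -
    \sum_a wave_re f a t * Phi (@multi_index n N a) x)).
    move=> x _; rewrite /= hermite_sum_cubeE.
    by case: (u x t).
  by apply: measurable_funB => //; exact: measurable_sum_Phi.
- apply: (eq_measurable_fun (fun x => (@complex.Im R \o (u ^~ t)) x -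
    \sum_a wave_im f a t * Phi (@multi_index n N a) x)).
    move=> x _; rewrite /= hermite_sum_cubeE.
    by case: (u x t).
  by apply: measurable_funB => //; exact: measurable_sum_Phi.
Qed.

Let msum N t : measurable_fun setT (fun x => normc (hermite_sum f (cube n N) t x) ^+ 2).
Proof.
apply: measurable_normc_sqr.
- apply: (eq_measurable_fun (fun x => \sum_a wave_re f a t * Phi (@multi_index n N a) x)).
    by move=> x _; rewrite /= hermite_sum_cubeE.
  exact: measurable_sum_Phi.
- apply: (eq_measurable_fun (fun x => \sum_a wave_im f a t * Phi (@multi_index n N a) x)).
    by move=> x _; rewrite /= hermite_sum_cubeE.
  exact: measurable_sum_Phi.
Qed.

(** The weight is kept on the partial sum, where its integral is known, and bounded by 1 on the
    error, which is small in L^2. *)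
Lemma energy_le N k t :
  (\int[leb n]_x (normc (u x t) ^+ 2 * gauss_weight S k%:R x)%:E <=
   (2 * @cube_energy R n N f S k%:R t)%:E +
   2%:E * L2norm (fun x => u x t - hermite_sum f (cube n N) t x)%R ^+ 2)%E.
Proof.
rewrite EFinM -integral_hermite_sum// L2norm_sqr.
have m1 : measurable_fun setT (fun x =>
    (normc (hermite_sum f (cube n N) t x) ^+ 2 * gauss_weight S k%:R x)%:E).
  by apply/measurable_EFinP; apply: measurable_funM => //; exact: measurable_gauss_weight.
have m2 : measurable_fun setT (fun x =>
    (normc (u x t - hermite_sum f (cube n N) t x) ^+ 2)%:E) by exact/measurable_EFinP.
have p1 x : (0 <= (normc (hermite_sum f (cube n N) t x) ^+ 2 * gauss_weight S k%:R x)%:E)%E.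
  by rewrite lee_fin mulr_ge0 ?sqr_ge0 ?gauss_weight_ge0.
have p2 x : (0 <= (normc (u x t - hermite_sum f (cube n N) t x) ^+ 2)%:E)%E.
  by rewrite lee_fin sqr_ge0.
rewrite -!ge0_integralZl// -ge0_integralD//; last 4 first.
- by move=> x _; rewrite mule_ge0.
- exact: measurable_funeM.
- by move=> x _; rewrite mule_ge0.
- exact: measurable_funeM.
apply: ge0_le_integral => //.
- by move=> x _; rewrite lee_fin mulr_ge0 ?sqr_ge0 ?gauss_weight_ge0.
- by apply/measurable_EFinP; apply: measurable_funM => //; exact: measurable_gauss_weight.
- by apply: emeasurable_funD; exact: measurable_funeM.
- move=> x _; rewrite -!EFinM -EFinD lee_fin.
  have := normc_sqr_le (u x t) (hermite_sum f (cube n N) t x).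
  have w0 := gauss_weight_ge0 S k%:R x.
  have w1 : gauss_weight S k%:R x <= 1 by exact: gauss_weight_le1.
  have := sqr_ge0 (normc (u x t - hermite_sum f (cube n N) t x)).
  move: (normc _ ^+ 2) (normc _ ^+ 2) (normc _ ^+ 2) (gauss_weight _ _ _) w0 w1.
  move=> A B D w w0 w1 *; nra.
Qed.

Lemma cube_L2_cvg t (e : R) : 0 < e -> \forall N \near \oo,
  (L2norm (fun x => u x t - hermite_sum f (cube n N) t x)%R ^+ 2 <= e%:E)%E.
Proof.
move=> e0; have [_ cu] := uf t.
(* A norm below both 1 and e has its square below e. *)
pose e' := Num.min 1 e.
have e'0 : 0 < e' by rewrite lt_min ltr01.
have /cu[A0 _ hA] : nbhs (0%E : \bar R) [set y | (y < e'%:E)%E].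
  by apply: open_ereal_lt'; rewrite lte_fin.
near=> N.
have : (L2norm (fun x => u x t - hermite_sum f (cube n N) t x)%R < e'%:E)%E.
  by apply: hA => /=; near: N; exact: sub_cube.
move: (L2norm_ge0 (fun x => u x t - hermite_sum f (cube n N) t x)).
case: (L2norm _) => [r|//|//]; rewrite lee_fin lte_fin => r0 re.
rewrite -EFin_expe lee_fin.
have : r <= 1 by rewrite (le_trans (ltW re))// ge_min lexx.
have : r <= e by rewrite (le_trans (ltW re))// ge_min lexx orbT.
nra.
Unshelve. all: by end_near.
Qed.

(** The same [N] truncates the cube and the series of Gaussian weights, so a single limit inferior
    serves both. *)
Definition approx_energy N t : R :=
  \sum_(k < N) 2 * @cube_energy R n N f S k%:R t.

Lemma approx_energy_ge0 N t : 0 <= approx_energy N t.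
Proof. by apply: sumr_ge0 => k _; rewrite mulr_ge0// cube_energy_ge0. Qed.

Lemma energy_le_limn_einf t :
  (\int[leb n]_x ((normc (u x t) ^+ 2)%:E * singular_weight x) <=
   limn_einf (fun N => (approx_energy N t)%:E))%E.
Proof.
pose I k := (\int[leb n]_x (normc (u x t) ^+ 2 * gauss_weight S k%:R x)%:E)%E.
have I0 k : (0 <= I k)%E.
  by apply: integral_ge0 => x _; rewrite lee_fin mulr_ge0 ?sqr_ge0 ?gauss_weight_ge0.
have -> : (\int[leb n]_x ((normc (u x t) ^+ 2)%:E * singular_weight x) =
    \sum_(k <oo) I k)%E.
  rewrite -integral_nneseries//; last 2 first.
  - move=> k; apply/measurable_EFinP; apply: measurable_funM => //.
    exact: measurable_gauss_weight.
  - by move=> k x _; rewrite lee_fin mulr_ge0 ?sqr_ge0 ?gauss_weight_ge0.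
  apply: eq_integral => x _; rewrite /singular_weight -nneseriesZl//.
  by move=> k _; rewrite lee_fin gauss_weight_ge0.
apply: lime_le; first by apply: is_cvg_nneseries.
apply: nearW => K; rewrite big_mkord; apply/lee_addgt0Pr => e e0.
rewrite -leeBlDr//; apply: le_limn_einf.
(* Each of the K weights costs an error 2 e', in total e K / (K + 1) <= e. *)
pose e' := e / (2 * K.+1%:R); have e'0 : 0 < e' by rewrite divr_gt0// mulr_gt0.
near=> N; rewrite leeBlDr//.
have KN : (K <= N)%N by near: N; exact: nbhs_infty_ge.
have dN : (L2norm (fun x => u x t - hermite_sum f (cube n N) t x)%R ^+ 2 <= e'%:E)%E.
  by near: N; exact: cube_L2_cvg.
apply: (@le_trans _ _ (\sum_(k < K) ((2 * @cube_energy R n N f S k%:R t)%:E + (2 * e')%:E))%E).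
  apply: lee_sum => k _; apply: le_trans (energy_le N k t) _.
  by rewrite leeD2l// EFinM lee_wpmul2l// lee_fin.
under eq_bigr do rewrite -EFinD.
rewrite sumEFin -EFinD lee_fin big_split/= lerD//.
  rewrite /approx_energy (big_ord_widen _ (fun k => 2 * @cube_energy R n N f S k%:R t) KN).
  rewrite big_mkcond/=; apply: ler_sum => k _.
  by case: ifP => // _; rewrite mulr_ge0// cube_energy_ge0.
rewrite sumr_const card_ord -[_ *+ K]mulr_natl /e'.
have -> : K%:R * (2 * (e / (2 * K.+1%:R))) = e * (K%:R / K.+1%:R).
  by field; rewrite nat1r pnatr_eq0.
by rewrite ler_piMr ?(ltW e0)// ler_pdivrMr// mul1r ler_nat.
Unshelve. all: by end_near.
Qed.

Lemma integral_approx_energy_le N :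
  (\int[mu]_(t in `[0%R, (2 * pi)%R]) (approx_energy N t)%:E <=
   (20 * pi)%:E * L2norm f ^+ 2)%E.
Proof.
have p0 : 0 <= pi :> R by exact: pi_ge0.
have b := bessel N f2.
apply: (@le_trans _ _ ((20 * pi)%:E * (\sum_(a : {ffun 'I_n -> 'I_N})
   (coef_re f a ^+ 2 + coef_im f a ^+ 2))%:E)%E); last first.
  by rewrite lee_wpmul2l// lee_fin mulr_ge0.
under eq_integral do rewrite /approx_energy -sumEFin.
rewrite ge0_integral_sum//; last 2 first.
- move=> k; apply/measurable_EFinP; apply: measurable_funM => //.
  exact: measurable_cube_energy.
- by move=> k t _; rewrite lee_fin mulr_ge0// cube_energy_ge0.
pose c (a : {ffun 'I_n -> 'I_N}) := coef_re f a ^+ 2 + coef_im f a ^+ 2.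
pose w k (a : {ffun 'I_n -> 'I_N}) := Num.sqrt (1 + k%:R)^-1 ^+ 3 *
  level_weight S (k%:R / (1 + k%:R)) (levelin S a) : R.
apply: (@le_trans _ _ (\sum_(k < N) (2 * (2 * pi * \sum_a c a * w k a))%:E)%E).
  apply: lee_sum => k _.
  under eq_integral do rewrite EFinM.
  rewrite ge0_integralZl//; last 2 first.
  - by apply/measurable_EFinP; exact: measurable_cube_energy.
  - by move=> t _; rewrite lee_fin cube_energy_ge0.
  by rewrite EFinM lee_wpmul2l// integral_cube_energy_le.
rewrite sumEFin -EFinM lee_fin -mulr_sumr -mulr_sumr exchange_big/=.
under eq_bigr do rewrite -mulr_sumr.
(* The sum over the weights is bounded for each a separately, uniformly in a and [N], which leaves
   the sum controlled by Bessel's inequality. *)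
apply: (@le_trans _ _ (2 * (2 * pi * \sum_a c a * 5))).
  do 2 (rewrite ler_wpM2l ?mulr_ge0//).
  apply: ler_sum => a _; rewrite ler_wpM2l ?addr_ge0 ?sqr_ge0//.
  exact: sum_level_weight_le.
by rewrite -mulr_suml le_eqVlt; apply/orP; left; apply/eqP; rewrite /c; ring.
Qed.

Lemma smoothing_estimate :
  (\int[mu]_(t in `[0%R, (2 * pi)%R])
     \int[leb n]_x ((normc (u x t) ^+ 2)%:E * singular_weight x) <=
   (20 * pi)%:E * L2norm f ^+ 2)%E.
Proof.
apply: (@le_trans _ _ (\int[mu]_(t in `[0%R, (2 * pi)%R])
    limn_einf (fun N => (approx_energy N t)%:E))%E).
  apply: ge0_le_integral_nonmeasurable => t _; last exact: energy_le_limn_einf.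
  apply: integral_ge0 => x _; apply: mule_ge0; last exact: singular_weight_ge0.
  by rewrite lee_fin sqr_ge0.
apply: le_trans (fatou _ _ _ _) _ => //.
- move=> N; apply/measurable_EFinP; apply: measurable_sum => k.
  by apply: measurable_funM => //; exact: measurable_cube_energy.
- by move=> N t _; rewrite lee_fin approx_energy_ge0.
by apply: limn_einf_le => N; exact: integral_approx_energy_le.
Qed.

End Solution.
End Smoothing.

Section WeightedEstimate.
Context {R : realType} (n : nat).

Lemma card_three (i j k : 'I_n) : i != j -> i != k -> j != k ->
  #|[pred l | [|| l == i, l == j | l == k]]| = 3%N.
Proof.
move=> ij ik jk; have /card_uniqP/= <- : uniq [:: i; j; k].
  by rewrite /= !inE negb_or ij ik jk.
by apply: eq_card => l; rewrite !inE.
Qed.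

Lemma sqr_dist_three (i j k : 'I_n) (x : n.-tuple R) : i != j -> i != k -> j != k ->
  sqr_dist [pred l | [|| l == i, l == j | l == k]] x =
  tnth x i ^+ 2 + tnth x j ^+ 2 + tnth x k ^+ 2.
Proof.
move=> ij ik jk; rewrite /sqr_dist (bigD1 i)/= ?eqxx//.
rewrite (bigD1 j)/=; last by rewrite eqxx orbT eq_sym.
rewrite (bigD1 k)/=; last by rewrite eqxx !orbT ![k == _]eq_sym ik jk.
rewrite big1 ?addr0 ?addrA// => l /andP[/andP[/andP[]]].
by case/or3P => /eqP ->; rewrite eqxx.
Qed.

Lemma weighted_estimate (S : pred 'I_n) (w : n.-tuple R -> R) : #|S| = 3%N ->
  (forall x, 0 <= w x) -> (forall x, w x <= 1 \/ w x * sqr_dist S x <= 1) ->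
  forall (f : n.-tuple R -> R[i]) (u : n.-tuple R -> R -> R[i]),
  in_L2 f -> schrodinger_solution f u ->
  (\int[lebesgue_measure]_(t in `[0%R, (2 * pi)%R])
     \int[leb n]_x (normc (u x t) ^+ 2 * w x)%:E
   <= (20 * pi)%:E * L2norm f ^+ 2)%E.
Proof.
move=> S3 w0 wS f u f2 uf; apply: le_trans (smoothing_estimate S3 f2 uf).
have p0 t x : (0 <= (normc (u x t) ^+ 2 * w x)%:E)%E.
  by rewrite lee_fin mulr_ge0 ?sqr_ge0.
apply: ge0_le_integral_nonmeasurable => t _; first exact: integral_ge0.
apply: ge0_le_integral_nonmeasurable => x _ //.
rewrite EFinM lee_wpmul2l ?lee_fin ?sqr_ge0//.
exact: le_singular_weight.
Qed.

End WeightedEstimate.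

Theorem theorem1 (R : realType) (n : nat) (hn : (3 <= n)%N) :
  (forall (delta : R) (i j k : 'I_n),
     0 <= delta <= 1 -> i != j -> i != k -> j != k ->
     exists C : R, 0 < C /\
       forall (f : n.-tuple R -> R[i]) (u : n.-tuple R -> R -> R[i]),
         in_L2 f -> schrodinger_solution f u ->
         (\int[lebesgue_measure]_(t in `[0%R, (2 * pi)%R])
            \int[leb n]_x
              (normc (u x t) ^+ 2
               / (tnth x i ^+ 2 + tnth x j ^+ 2 + tnth x k ^+ 2) `^ delta)%:E
          <= C%:E * L2norm f ^+ 2)%E)
  /\
  (exists C : R, 0 < C /\
     forall (f : n.-tuple R -> R[i]) (u : n.-tuple R -> R -> R[i]),
       in_L2 f -> schrodinger_solution f u ->
       (\int[lebesgue_measure]_(t in `[0%R, (2 * pi)%R])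
          \int[leb n]_x
            (normc (u x t) ^+ 2 / \sum_(l < n) tnth x l ^+ 2)%:E
        <= C%:E * L2norm f ^+ 2)%E).
Proof.
have C0 : 0 < 20 * pi :> R by rewrite mulr_gt0// pi_gt0.
split=> [delta i j k /andP[d0 d1] ij ik jk|]; exists (20 * pi); split=> // f u.
  apply: (weighted_estimate (w := fun x =>
    ((tnth x i ^+ 2 + tnth x j ^+ 2 + tnth x k ^+ 2) `^ delta)^-1)
    (card_three ij ik jk)) => x; first by rewrite invr_ge0 powR_ge0.
  rewrite sqr_dist_three//; set r := _ + _ + _.
  have r0 : 0 <= r by rewrite !addr_ge0 ?sqr_ge0.
  (* For r >= 1 the weight r^(-delta) is at most 1; for r < 1 it is at most 1 / r, since r <=
     r^delta. *)
  have [r1|r1] := lerP 1 r.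
    left; rewrite invf_le1 ?powR_gt0 ?(lt_le_trans _ r1)//.
    by rewrite -(powRr0 r) ler_powR.
  right; move: r0; rewrite le_eqVlt => /predU1P[<-|r0]; first by rewrite mulr0.
  rewrite mulrC ler_pdivrMr ?powR_gt0// mul1r; apply: ger1_powR => //.
  by rewrite r0 ltW.
(* Any three coordinates would do, as the sum of all squares dominates theirs; at the origin the
   weight takes the value 0, the inverse of 0. *)
have h0 : (0 < n)%N by lia. have h1 : (1 < n)%N by lia.
have S3 := @card_three n (Ordinal h0) (Ordinal h1) (Ordinal hn) isT isT isT.
apply: (weighted_estimate (w := fun x => (\sum_(l < n) tnth x l ^+ 2)^-1) S3) => x.
  by rewrite invr_ge0; apply: sumr_ge0 => l _; exact: sqr_ge0.
right; set r := \sum_(l < n) _.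
have r0 : 0 <= r by apply: sumr_ge0 => l _; exact: sqr_ge0.
move: (r0); rewrite le_eqVlt => /predU1P[<-|rp]; first by rewrite invr0 mul0r.
rewrite mulrC ler_pdivrMr// mul1r /sqr_dist big_mkcond/=.
by apply: ler_sum => l _; case: ifP => // _; exact: sqr_ge0.
Qed.
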